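(* Let $\eta\in\{0,1\}$ and let $P,Q$ be processes with $\vdash_\eta P$ and $\vdash_\eta Q$. If $P \approx_s^{\eta} Q$ (sequential bisimilarity at $\eta$), then $P \simeq_\eta Q$ (sequential barbed equivalence at $\eta$).
   Context: Asynchronous $\pi$-calculus: processes $P ::= a\langle\tilde b\rangle \mid\ !a(\tilde b).P \mid P|Q \mid (\nu a)P \mid G$, with guarded processes $G ::= \mathbf 0 \mid a(\tilde b).P \mid \tau.P \mid [a=b]G \mid G+G'$. All processes are well-sorted under a fixed sorting (names partitioned into sorts, each sort determining the sorts of the tuples it carries). $P\xrightarrow{\mu}P'$ is the standard early labelled transition system of the asynchronous $\pi$-calculus, with actions $\mu ::= \tau \mid a(\tilde b)$ (early input of $\tilde b$ at $a$) $\mid (\nu\tilde c)a\langle\tilde b\rangle$ (output with possible extrusion of $\tilde c\subseteq\tilde b$); $a$ is the subject. $\Longrightarrow$ is the reflexive–transitive closure of $\xrightarrow{\tau}$, and $\stackrel{\hat\mu}{\Longrightarrow}$ is $\Longrightarrow$ if $\mu=\tau$ and $\Longrightarrow\xrightarrow{\mu}\Longrightarrow$ otherwise; $P\longrightarrow P'$ means $P\xrightarrow{\tau}P'$. A static context is $E=(\nu\tilde a)(R\mid[\cdot])$. Sequentiality: names are partitioned into output-controlled names ($x,y,z$) and input-controlled names ($u,v,w$); $a,b,c$ range over all names. Judgements $\vdash_\eta P$, $\eta\in\{0,1\}$ ($1$ = active), are given by the rules: $\vdash_1 u(\tilde a).P$ if $\vdash_1 P$; $\vdash_0 x(\tilde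 a).P$ and $\vdash_0 !x(\tilde a).P$ if $\vdash_1 P$; $\vdash_1 x\langle\tilde a\rangle$; $\vdash_0 u\langle\tilde a\rangle$; $\vdash_\eta(\nu a)P$ if $\vdash_\eta P$; $\vdash_0\mathbf 0$; $\vdash_{\eta_1+\eta_2}P|Q$ if $\vdash_{\eta_1}P$, $\vdash_{\eta_2}Q$ and $\eta_1+\eta_2\le1$; $\vdash_\eta G_1+G_2$ if $\vdash_\eta G_1$ and $\vdash_\eta G_2$; $\vdash_\eta\tau.P$ if $\vdash_\eta P$; $\vdash_0[a=b]G$ if $\vdash_0 G$. A type-allowed transition $\eta\vdash P\xrightarrow{\mu}P'$ holds if $\vdash_\eta P$, $P\xrightarrow{\mu}P'$, and either $\eta=0$, or $\mu=\tau$, or $\eta=1$ and $\mu$ is an input $u(\tilde a)$ at an input-controlled name or an output $(\nu\tilde a)x\langle\tilde b\rangle$ at an output-controlled name. Write $\langle\eta;P\rangle\xrightarrow{\mu}\langle\eta';P'\rangle$ if $\eta\vdash P\xrightarrow{\mu}P'$ and $\eta'=1$ if $\mu$ is an input at an output-controlled name, $\eta'=0$ if $\mu$ is an output at an output-controlled name, $\eta'=\eta$ otherwise. Weakly, $\eta\vdash P\stackrel{\mu}{\Longrightarrow}P'$ if $P\Longrightarrow P_0$, $\eta\vdash P_0\xrightarrow{\mu}P_1$, $P_1\Longrightarrow P'$. Sequential bisimulation: a set $\mathcal R$ of triples $(\eta,P,Q)$ with $\vdash_\eta P,Q$ such that whenever $(\eta,P,Q)\in\mathcal R$ and $\langle\eta;P\rangle\xrightarrow{\mu}\langle\eta';P'\rangle$,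 either $Q\stackrel{\hat\mu}{\Longrightarrow}Q'$ with $(\eta',P',Q')\in\mathcal R$, or $\mu=a(\tilde b)$ and $Q|a\langle\tilde b\rangle\Longrightarrow Q'$ with $(\eta',P',Q')\in\mathcal R$; and symmetrically for transitions of $Q$. $P\approx_s^\eta Q$ if $(\eta,P,Q)$ belongs to some sequential bisimulation. Barbed equivalence: $\eta\vdash P\Downarrow_a$ if there are $P'$ and an output action $\mu$ with subject $a$ such that $\eta\vdash P\stackrel{\mu}{\Longrightarrow}P'$. Barbed bisimilarity $\dot\approx_\eta$ is the largest symmetric relation on processes $P$ with $\vdash_\eta P$ such that $P\dot\approx_\eta Q$ implies: if $P\longrightarrow P'$ then $Q\Longrightarrow Q'$ with $P'\dot\approx_\eta Q'$; and for all names $a$, $\eta\vdash P\Downarrow_a$ iff $\eta\vdash Q\Downarrow_a$. $P\simeq_\eta Q$ if $\vdash_\eta P,Q$ and for every $\eta'$ and every static context $E$ that is typable as $\vdash_{\eta'}E$ when the hole is given type $\vdash_\eta[\cdot]$, we have $E[P]\dot\approx_{\eta'}E[Q]$. *)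

(* Defs.v *)
From mathcomp Require Import all_boot.
From Stdlib Require Import Relation_Operators.

Set Implicit Arguments.
Unset Strict Implicit.
Unset Printing Implicit Defensive.

(* Names are natural numbers.  [outctl s] says that the names of sort [s] are
   output-controlled; otherwise they are input-controlled.  Control is a
   function of the sort, so that communication, which instantiates a bound name
   only by names of the same sort, cannot change the control of a name. *)
Record sorting := Sorting {
  srt : Type;
  obj : srt -> seq srt;
  outctl : srt -> bool;
  sort_of : nat -> srt;
  sort_of_infinite : forall s n, exists2 m, n <= m & sort_of m = s
}.

(* Processes up to alpha-conversion, with de Bruijn binders: [Nu s P] binds
   name 0 of [P], of sort [s]; [Inp a ss P] and [Rep a ss P] bind names
   0, ..., size ss - 1 of [P], of sorts [ss].  Under n binders, name i of the
   surrounding scope is written n + i. *)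
Inductive proc (T : Type) : Type :=
  | Out of nat & seq nat
  | Rep of nat & seq T & proc T
  | Par of proc T & proc T
  | Nu of T & proc T
  | Grd of guarded T
with guarded (T : Type) : Type :=
  | Nil
  | Inp of nat & seq T & proc T
  | Tau of proc T
  | Match of nat & nat & guarded T
  | Sum of guarded T & guarded T.

Arguments Out {T}.
Arguments Nil {T}.

(* The stream xs_0, ..., xs_(n-1), f 0, f 1, ... *)
Definition scons (T : Type) (xs : seq T) (f : nat -> T) (i : nat) : T :=
  nth (f (i - size xs)) xs i.

Definition up (n : nat) (f : nat -> nat) : nat -> nat :=
  scons (iota 0 n) (fun i => n + f i).

Fixpoint ren (T : Type) (f : nat -> nat) (P : proc T) : proc T :=
  match P with
  | Out a bs => Out (f a) (map f bs)
  | Rep a ss P => Rep (f a) ss (ren (up (size ss) f) P)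
  | Par P Q => Par (ren f P) (ren f Q)
  | Nu s P => Nu s (ren (up 1 f) P)
  | Grd G => Grd (renG f G)
  end
with renG (T : Type) (f : nat -> nat) (G : guarded T) : guarded T :=
  match G with
  | Nil => Nil
  | Inp a ss P => Inp (f a) ss (ren (up (size ss) f) P)
  | Tau P => Tau (ren f P)
  | Match a b G => Match (f a) (f b) (renG f G)
  | Sum G1 G2 => Sum (renG f G1) (renG f G2)
  end.

(* [inst bs P] replaces the bound names 0, ..., size bs - 1 of the body of an
   input by [bs]. *)
Definition inst (T : Type) (bs : seq nat) (P : proc T) : proc T :=
  ren (scons bs id) P.

Definition unbind (n : nat) (xs : seq nat) : seq nat :=
  [seq x - n | x <- xs & n <= x].

Fixpoint fn (T : Type) (P : proc T) : seq nat :=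
  match P with
  | Out a bs => a :: bs
  | Rep a ss P => a :: unbind (size ss) (fn P)
  | Par P Q => fn P ++ fn Q
  | Nu _ P => unbind 1 (fn P)
  | Grd G => fnG G
  end
with fnG (T : Type) (G : guarded T) : seq nat :=
  match G with
  | Nil => [::]
  | Inp a ss P => a :: unbind (size ss) (fn P)
  | Tau P => fn P
  | Match a b G => [:: a, b & fnG G]
  | Sum G1 G2 => fnG G1 ++ fnG G2
  end.

Definition disjoint_seq (xs ys : seq nat) : bool := ~~ has (mem ys) xs.

(* [LOut cs a bs] is the action (nu cs) a<bs>. *)
Inductive action : Type :=
  | LTau
  | LIn of nat & seq nat
  | LOut of seq nat & nat & seq nat.

Definition bn (mu : action) : seq nat :=
  if mu is LOut cs _ _ then cs else [::].

Definition act_names (mu : action) : seq nat :=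
  match mu with
  | LTau => [::]
  | LIn a bs => a :: bs
  | LOut cs a bs => cs ++ a :: bs
  end.

Section Calculus.
Variable S : sorting.
Local Notation proc := (proc (srt S)).
Local Notation guarded := (guarded (srt S)).
Local Notation env := (nat -> srt S).

(* [G] gives the sorts of the names in scope. *)
Fixpoint wsorted_in (G : env) (P : proc) : Prop :=
  match P with
  | Out a bs => map G bs = obj (G a)
  | Rep a ss P => ss = obj (G a) /\ wsorted_in (scons ss G) P
  | Par P Q => wsorted_in G P /\ wsorted_in G Q
  | Nu s P => wsorted_in (scons [:: s] G) P
  | Grd M => wsortedG_in G M
  end
with wsortedG_in (G : env) (M : guarded) : Prop :=
  match M with
  | Nil => True
  | Inp a ss P => ss = obj (G a) /\ wsorted_in (scons ss G) P
  | Tau P => wsorted_in G P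
  | Match a b M => wsortedG_in G M
  | Sum M1 M2 => wsortedG_in G M1 /\ wsortedG_in G M2
  end.

(* Activities 0 and 1 are [false] and [true]. *)
Inductive typed_in : env -> bool -> proc -> Prop :=
  | T_InpI G a ss P :
      ~~ outctl (G a) -> typed_in (scons ss G) true P ->
      typed_in G true (Grd (Inp a ss P))
  | T_InpO G a ss P :
      outctl (G a) -> typed_in (scons ss G) true P ->
      typed_in G false (Grd (Inp a ss P))
  | T_RepO G a ss P :
      outctl (G a) -> typed_in (scons ss G) true P ->
      typed_in G false (Rep a ss P)
  | T_OutO G a bs : outctl (G a) -> typed_in G true (Out a bs)
  | T_OutI G a bs : ~~ outctl (G a) -> typed_in G false (Out a bs)
  | T_Nu G eta s P :
      typed_in (scons [:: s] G) eta P -> typed_in G eta (Nu s P)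
  | T_Nil G : typed_in G false (Grd Nil)
  (* Since [eta : bool] is coerced to nat, the equation entails
     eta1 + eta2 <= 1. *)
  | T_Par G (eta1 eta2 eta : bool) P Q :
      typed_in G eta1 P -> typed_in G eta2 Q -> eta1 + eta2 = eta ->
      typed_in G eta (Par P Q)
  | T_Sum G eta M1 M2 :
      typed_in G eta (Grd M1) -> typed_in G eta (Grd M2) ->
      typed_in G eta (Grd (Sum M1 M2))
  | T_Tau G eta P : typed_in G eta P -> typed_in G eta (Grd (Tau P))
  | T_Match G a b M :
      typed_in G false (Grd M) -> typed_in G false (Grd (Match a b M)).

(* The judgement |-_eta P, on well-sorted processes. *)
Definition typed (eta : bool) (P : proc) : Prop :=
  wsorted_in (@sort_of S) P /\ typed_in (@sort_of S) eta P.

(* (nu a) P for a free name [a] of [P], which gets bound. *)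
Definition res (a : nat) (P : proc) : proc :=
  Nu (sort_of S a) (ren (fun b => if b == a then 0 else b.+1) P).

Definition ress (cs : seq nat) (P : proc) : proc := foldr res P cs.

(* Alpha-conversion is implicit: for [b] fresh for [P] and of the sort of [a],
   [res a P] and [res b (P{b/a})] are the same term.  The extruded names of an output action
   form a set: [L_Open] derives all their orderings. *)
Inductive lts : proc -> action -> proc -> Prop :=
  | L_Out a bs : lts (Out a bs) (LOut [::] a bs) (Grd Nil)
  | L_Inp a ss P bs :
      map (@sort_of S) bs = ss ->
      lts (Grd (Inp a ss P)) (LIn a bs) (inst bs P)
  | L_Rep a ss P bs :
      map (@sort_of S) bs = ss ->
      lts (Rep a ss P) (LIn a bs) (Par (inst bs P) (Rep a ss P))
  | L_Tau P : lts (Grd (Tau P)) LTau P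
  | L_Match a M mu P' :
      lts (Grd M) mu P' -> lts (Grd (Match a a M)) mu P'
  | L_SumL M1 M2 mu P' :
      lts (Grd M1) mu P' -> lts (Grd (Sum M1 M2)) mu P'
  | L_SumR M1 M2 mu P' :
      lts (Grd M2) mu P' -> lts (Grd (Sum M1 M2)) mu P'
  | L_ParL P Q mu P' :
      lts P mu P' -> disjoint_seq (bn mu) (fn Q) ->
      lts (Par P Q) mu (Par P' Q)
  | L_ParR P Q mu Q' :
      lts Q mu Q' -> disjoint_seq (bn mu) (fn P) ->
      lts (Par P Q) mu (Par P Q')
  | L_ComL P Q cs a bs P' Q' :
      lts P (LOut cs a bs) P' -> lts Q (LIn a bs) Q' ->
      disjoint_seq cs (fn Q) ->
      lts (Par P Q) LTau (ress cs (Par P' Q'))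
  | L_ComR P Q cs a bs P' Q' :
      lts P (LIn a bs) P' -> lts Q (LOut cs a bs) Q' ->
      disjoint_seq cs (fn P) ->
      lts (Par P Q) LTau (ress cs (Par P' Q'))
  | L_Res a P mu P' :
      lts P mu P' -> a \notin act_names mu ->
      lts (res a P) mu (res a P')
  | L_Open c P cs cs' a bs P' :
      lts P (LOut cs a bs) P' ->
      c != a -> c \in bs -> c \notin cs -> perm_eq cs' (c :: cs) ->
      lts (res c P) (LOut cs' a bs) P'.

Definition taus : proc -> proc -> Prop :=
  clos_refl_trans proc (fun P P' => lts P LTau P').

Definition wlts (P : proc) (mu : action) (P' : proc) : Prop :=
  exists P0 P1, [/\ taus P P0, lts P0 mu P1 & taus P1 P'].

Definition wlts_hat (P : proc) (mu : action) (P' : proc) : Prop :=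
  if mu is LTau then taus P P' else wlts P mu P'.

Definition allowed (eta : bool) (mu : action) : Prop :=
  [\/ eta = false, mu = LTau |
      eta = true /\
      match mu with
      | LTau => False
      | LIn a _ => ~~ outctl (sort_of S a)
      | LOut _ a _ => outctl (sort_of S a)
      end].

Definition tlts (eta : bool) (P : proc) (mu : action) (P' : proc) : Prop :=
  [/\ typed eta P, lts P mu P' & allowed eta mu].

Definition next (eta : bool) (mu : action) : bool :=
  match mu with
  | LTau => eta
  | LIn a _ => if outctl (sort_of S a) then true else eta
  | LOut _ a _ => if outctl (sort_of S a) then false else eta
  end.

Definition cfg_step (eta : bool) (P : proc) (mu : action)
    (eta' : bool) (P' : proc) : Prop :=
  tlts eta P mu P' /\ eta' = next eta mu.

Definition wtlts (eta : bool) (P : proc) (mu : action) (P' : proc) : Prop :=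
  exists P0 P1, [/\ taus P P0, tlts eta P0 mu P1 & taus P1 P'].

(* [Q] answers the transition [mu] into a process [Q'] satisfying [K]. *)
Definition answers (Q : proc) (mu : action) (K : proc -> Prop) : Prop :=
  (exists2 Q', wlts_hat Q mu Q' & K Q') \/
  (exists a bs, mu = LIn a bs /\
     exists2 Q', taus (Par Q (Out a bs)) Q' & K Q').

(* The disjointness conditions are the usual convention that the bound names
   of a challenge are fresh for the answering process. *)
Definition sequential_bisimulation (R : bool -> proc -> proc -> Prop) : Prop :=
  forall eta P Q, R eta P Q ->
  [/\ typed eta P, typed eta Q,
      forall mu eta' P', cfg_step eta P mu eta' P' ->
        disjoint_seq (bn mu) (fn Q) ->
        answers Q mu (fun Q' => R eta' P' Q') &
      forall mu eta' Q', cfg_step eta Q mu eta' Q' ->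
        disjoint_seq (bn mu) (fn P) ->
        answers P mu (fun P' => R eta' P' Q')].

Definition sequential_bisimilar (eta : bool) (P Q : proc) : Prop :=
  exists2 R, sequential_bisimulation R & R eta P Q.

Definition barb (eta : bool) (P : proc) (a : nat) : Prop :=
  exists cs bs P', wtlts eta P (LOut cs a bs) P'.

Definition barbed_bisimulation (eta : bool) (R : proc -> proc -> Prop) : Prop :=
  (forall P Q, R P Q -> R Q P) /\
  (forall P Q, R P Q ->
   [/\ typed eta P, typed eta Q,
       forall P', lts P LTau P' -> exists2 Q', taus Q Q' & R P' Q' &
       forall a, barb eta P a <-> barb eta Q a]).

Definition barbed_bisimilar (eta : bool) (P Q : proc) : Prop :=
  exists2 R, barbed_bisimulation eta R & R P Q.

(* The static context (nu ctx_names)(ctx_proc | [.]); filling it captures the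
   free names in [ctx_names]. *)
Record static_context := StaticContext {
  ctx_names : seq nat;
  ctx_proc : proc
}.

Definition fill (E : static_context) (P : proc) : proc :=
  ress (ctx_names E) (Par (ctx_proc E) P).

(* |-_eta' E with hole |-_eta [.]: the rule for parallel composition, followed
   by the rules for restriction, which leave the activity unchanged. *)
Definition ctx_typed (eta eta' : bool) (E : static_context) : Prop :=
  exists2 etaR : bool, typed etaR (ctx_proc E) & etaR + eta = eta'.

Definition barbed_equivalent (eta : bool) (P Q : proc) : Prop :=
  [/\ typed eta P, typed eta Q &
      forall eta' E, ctx_typed eta eta' E ->
        barbed_bisimilar eta' (fill E P) (fill E Q)].

End Calculus.

(* Main.v *)
Require Import Defs.
From mathcomp Require Import all_boot.
From Stdlib Require Import Relation_Operators.

Set Implicit Arguments.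
Unset Strict Implicit.
Unset Printing Implicit Defensive.

(* Given a sequential bisimulation, the pairs of processes structurally
   congruent to (nu ns)(R | P) and (nu ns)(R | Q), for (eta, P, Q) in the
   bisimulation and R typable next to activity eta, form a barbed bisimulation.
   At most one of R and P is active, so each visible action that P contributes
   to a communication with R is type-allowed and can be answered by Q.  If Q
   answers an input of P by Q | a<bs> ==> Q', then R supplies the message: a
   process that can output a<bs> is structurally congruent to one where a<bs>
   is pending in parallel. *)

(* [res c P] is a function of a free name, so a transition of it is derived for some representative
   of the alpha-class whose bound name need not be [c]. Inversion yields another name and body,
   related to the given ones by a swap, and arguments about scope therefore begin by choosing names
   fresh for everything around. Equivariance of transitions under injective, sort-preserving
   renamings makes these choices possible.

   Closing the relation under structural congruence is forced by the message clause: the reductions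
   of Q | a<bs> start from a process in which the message is still pending, and this process is only
   congruent to the one that has to answer. Congruence must therefore be shown to be a strong
   bisimulation. *)
Scheme proc_mind := Induction for proc Sort Prop
  with guarded_mind := Induction for guarded Sort Prop.
Combined Scheme proc_guarded_ind from proc_mind, guarded_mind.

(** * Renaming *)

Section Renaming.
Variable T : Type.
Implicit Types (P : proc T) (M : guarded T) (f g : nat -> nat) (xs : seq nat).

Lemma upE n f i : up n f i = if i < n then i else n + f (i - n).
Proof.
rewrite /up /scons size_iota; case: ltnP => h; first by rewrite nth_iota.
by rewrite nth_default ?size_iota.
Qed.

Lemma mem_unbind n xs x : (x \in unbind n xs) = (n + x \in xs).
Proof.
apply/mapP/idP => [[y]|h]; last by exists (n + x); rewrite ?mem_filter ?h ?leq_addr // addKn.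
by rewrite mem_filter => /andP[le_ny y_xs ->]; rewrite subnKC.
Qed.

Lemma unbind_map_up n f xs : unbind n (map (up n f) xs) = map f (unbind n xs).
Proof.
elim: xs => //= x xs; rewrite /unbind /= upE.
case: (ltnP x n) => h; first by rewrite leqNgt h.
by rewrite leq_addr /= => ->; rewrite addKn.
Qed.

Lemma fn_ren_mut :
  (forall P f, fn (ren f P) = map f (fn P)) /\
  (forall M f, fnG (renG f M) = map f (fnG M)).
Proof.
apply: proc_guarded_ind => //=.
- by move=> a ss P IH f; rewrite IH unbind_map_up.
- by move=> P IHP Q IHQ f; rewrite IHP IHQ map_cat.
- by move=> s P IH f; rewrite IH unbind_map_up.
- by move=> a ss P IH f; rewrite IH unbind_map_up.
- by move=> a b M IH f; rewrite IH.
- by move=> M IHM N IHN f; rewrite IHM IHN map_cat.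
Qed.

Lemma fn_ren P f : fn (ren f P) = map f (fn P).
Proof. by case: fn_ren_mut => h _; apply: h. Qed.

Lemma up_ext n f g xs :
  {in unbind n xs, f =1 g} -> {in xs, up n f =1 up n g}.
Proof.
move=> h x xin; rewrite !upE; case: ltnP => // le_nx.
by rewrite h // mem_unbind subnKC.
Qed.

(** Agreement on the free names suffices. With [g] the identity, a renaming that fixes the free
    names of [P] leaves [P] unchanged, which is how alpha-conversion is obtained later. *)
Lemma ren_ext_mut :
  (forall P f g, {in fn P, f =1 g} -> ren f P = ren g P) /\
  (forall M f g, {in fnG M, f =1 g} -> renG f M = renG g M).
Proof.
apply: proc_guarded_ind => //=.
- move=> a bs f g h; rewrite h ?mem_head //; congr Out.
  by apply/eq_in_map => x xin; apply: h; rewrite inE xin orbT.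
- move=> a ss P IH f g h; rewrite h ?mem_head //; congr Rep.
  by apply/IH/up_ext => x xin; apply: h; rewrite inE xin orbT.
- move=> P IHP Q IHQ f g h.
  by rewrite (IHP f g) ?(IHQ f g) // => x xin; apply: h; rewrite mem_cat xin ?orbT.
- by move=> s P IH f g h; congr Nu; apply/IH/up_ext.
- by move=> M IH f g h; congr Grd; apply: IH.
- move=> a ss P IH f g h; rewrite h ?mem_head //; congr Inp.
  by apply/IH/up_ext => x xin; apply: h; rewrite inE xin orbT.
- by move=> P IH f g h; congr Tau; apply: IH.
- move=> a b M IH f g h.
  rewrite (h a) ?(h b) ?(IH f g) ?inE ?eqxx ?orbT // => x xin.
  by apply: h; rewrite !inE xin !orbT.
- move=> P IHP Q IHQ f g h.
  by rewrite (IHP f g) ?(IHQ f g) // => x xin; apply: h; rewrite mem_cat xin ?orbT.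
Qed.

Lemma ren_ext P f g : {in fn P, f =1 g} -> ren f P = ren g P.
Proof. by case: ren_ext_mut => h _; apply: h. Qed.

Lemma up_comp n f g : up n g \o up n f =1 up n (g \o f).
Proof.
move=> x /=; rewrite !upE; case: (ltnP x n) => [->//|le_nx].
by rewrite ltnNge leq_addr /= addKn.
Qed.

Lemma ren_comp_mut :
  (forall P f g, ren g (ren f P) = ren (g \o f) P) /\
  (forall M f g, renG g (renG f M) = renG (g \o f) M).
Proof.
have upc n P f g : ren (up n g \o up n f) P = ren (up n (g \o f)) P.
  by apply: ren_ext => x _; apply: up_comp.
apply: proc_guarded_ind => //=.
- by move=> a bs f g; rewrite -map_comp.
- by move=> a ss P IH f g; rewrite IH upc.
- by move=> P IHP Q IHQ f g; rewrite IHP IHQ.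
- by move=> s P IH f g; rewrite IH upc.
- by move=> M IH f g; rewrite IH.
- by move=> a ss P IH f g; rewrite IH upc.
- by move=> P IH f g; rewrite IH.
- by move=> a b M IH f g; rewrite IH.
- by move=> P IHP Q IHQ f g; rewrite IHP IHQ.
Qed.

Lemma ren_comp P f g : ren g (ren f P) = ren (g \o f) P.
Proof. by case: ren_comp_mut => h _; apply: h. Qed.

Lemma up_id n : up n id =1 id.
Proof. by move=> x; rewrite upE; case: ltnP => // h; rewrite subnKC. Qed.

Lemma ren_id_mut :
  (forall P, ren id P = P) /\ (forall M, renG id M = M).
Proof.
have upi n P : ren (up n id) P = ren id P.
  by apply: ren_ext => x _; apply: up_id.
apply: proc_guarded_ind => //=.
- by move=> a bs; rewrite map_id.
- by move=> a ss P IH; rewrite upi IH.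
- by move=> P -> Q ->.
- by move=> s P IH; rewrite upi IH.
- by move=> M ->.
- by move=> a ss P IH; rewrite upi IH.
- by move=> P ->.
- by move=> a b M ->.
- by move=> P -> Q ->.
Qed.

Lemma ren_id_in P f : {in fn P, f =1 id} -> ren f P = P.
Proof. by move/ren_ext->; case: ren_id_mut => h _; apply: h. Qed.

Lemma ren_inst f bs n P :
  size bs = n -> ren f (inst bs P) = inst (map f bs) (ren (up n f) P).
Proof.
move=> <-; rewrite /inst !ren_comp; apply: ren_ext => x _ /=.
rewrite /scons upE size_map; case: ltnP => h.
  by rewrite (nth_map 0) //; congr f; apply: set_nth_default.
by rewrite !nth_default ?size_map ?leq_addr // addKn.
Qed.

Lemma mem_fn_inst bs n P :
  size bs = n -> {subset fn (inst bs P) <= unbind n (fn P) ++ bs}.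
Proof.
move=> <- y; rewrite /inst fn_ren => /mapP[x xin ->]; rewrite mem_cat.
rewrite /scons; case: (ltnP x (size bs)) => h; first by rewrite mem_nth ?orbT.
by rewrite nth_default // mem_unbind subnKC ?xin.
Qed.

End Renaming.

(** * Disjointness, name swaps and renaming of actions *)

Lemma disjoint_seqP (xs ys : seq nat) :
  reflect {in xs, forall x, x \notin ys} (disjoint_seq xs ys).
Proof. by apply: (iffP hasPn) => h x /h. Qed.

(** A transposition rather than a one-way replacement: being an involution it is injective on all
    names, so freshness and disjointness conditions survive it. *)
Definition swap (a b x : nat) : nat :=
  if x == a then b else if x == b then a else x.

Lemma swapK a b : involutive (swap a b).
Proof. by move=> x; rewrite /swap; do ![case: eqP => //]; congruence. Qed.

Lemma swap_inj a b : injective (swap a b).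
Proof. exact: inv_inj (swapK a b). Qed.

Lemma swapL a b : swap a b a = b.
Proof. by rewrite /swap eqxx. Qed.

Lemma swapC a b : swap a b =1 swap b a.
Proof. by move=> x; rewrite /swap; do ![case: eqP => //]; congruence. Qed.

Lemma swap_id a b x : x != a -> x != b -> swap a b x = x.
Proof. by rewrite /swap => /negbTE-> /negbTE->. Qed.

Definition act_ren (f : nat -> nat) (mu : action) : action :=
  match mu with
  | LTau => LTau
  | LIn a bs => LIn (f a) (map f bs)
  | LOut cs a bs => LOut (map f cs) (f a) (map f bs)
  end.

Lemma act_names_ren f mu : act_names (act_ren f mu) = map f (act_names mu).
Proof. by case: mu => //= cs a bs; rewrite map_cat. Qed.

Lemma bn_ren f mu : bn (act_ren f mu) = map f (bn mu).
Proof. by case: mu. Qed.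

Lemma act_ren_comp f g mu : act_ren g (act_ren f mu) = act_ren (g \o f) mu.
Proof. by case: mu => //= *; rewrite -!map_comp. Qed.

Lemma act_ren_id_in f mu :
  {in act_names mu, f =1 id} -> act_ren f mu = mu.
Proof.
have mid (bs : seq nat) : {in bs, f =1 id} -> map f bs = bs.
  by move=> h; rewrite -[RHS]map_id; apply/eq_in_map.
case: mu => //= [a bs|cs a bs] h.
  by rewrite h ?mem_head // mid // => x xin; apply: h; rewrite inE xin orbT.
rewrite (h a) ?mem_cat ?mem_head ?orbT // !mid // => x xin;
by apply: h; rewrite mem_cat ?inE xin ?orbT.
Qed.

Lemma disjoint_map f (xs ys : seq nat) :
  injective f -> disjoint_seq xs ys -> disjoint_seq (map f xs) (map f ys).
Proof.
by move=> fI /disjoint_seqP h; apply/disjoint_seqP => _ /mapP[x xin ->]; rewrite mem_map ?h.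
Qed.

Section Theory.
Variable S : sorting.
Local Notation proc := (proc (srt S)).
Local Notation guarded := (guarded (srt S)).
Local Notation sort := (@sort_of S).
Implicit Types (P Q R T U V : proc) (M : guarded) (mu : action).
Implicit Types (a b c d e : nat) (cs bs ns X : seq nat) (eta : bool).

(** * Fresh names, equivariance and alpha-conversion of restrictions *)

Lemma fresh_name X (s : srt S) : exists2 c, c \notin X & sort c = s.
Proof.
have [c le_c sc] := sort_of_infinite s (\max_(x <- X) x).+1.
exists c => //; apply/negP => cX; move: le_c.
by rewrite ltnNge (@leq_bigmax_seq _ X xpredT id c cX).
Qed.

(** The renamings under which transitions are equivariant: injectivity preserves the freshness side
    conditions, and sorts must be kept because inputs check the sorts of received names and [res]
    records the sort of the bound name. *)
Definition sort_inj (f : nat -> nat) : Prop :=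
  injective f /\ forall x, sort (f x) = sort x.

Lemma swap_sort_inj a b : sort a = sort b -> sort_inj (swap a b).
Proof.
move=> h; split=> [|x]; first exact: swap_inj.
by rewrite /swap; case: eqP => [->|_] //; case: eqP => [->|].
Qed.

Lemma sort_inj_comp f g : sort_inj f -> sort_inj g -> sort_inj (g \o f).
Proof. by move=> [fI fS] [gI gS]; split=> [|x /=]; [exact: inj_comp|rewrite gS]. Qed.

Lemma fresh_ren X cs : exists f,
  [/\ sort_inj f, {in cs, forall c, f c \notin X} &
      forall x, x \in X -> x \notin cs -> f x = x].
Proof.
elim: cs => [|c cs [f [fI fcs fX]]]; first by exists id; split=> //; split.
(* Avoiding the image of [cs] as well ensures that the new swap does not move an already treated
   name back into [X]. *)
have [d] := fresh_name (X ++ map f (c :: cs)) (sort (f c)).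
rewrite mem_cat negb_or => /andP[dX dcs] ds.
exists (swap (f c) d \o f); split.
- by apply: sort_inj_comp => //; apply: swap_sort_inj; rewrite ds.
- move=> x; rewrite inE => /orP[/eqP->|xcs] /=; first by rewrite swapL.
  rewrite /swap; case: eqP => // _; case: eqP => [e|_]; last exact: fcs.
  by move: dcs; rewrite -e map_f // inE xcs orbT.
- move=> x xX; rewrite inE negb_or => /andP[xc xcs] /=.
  rewrite (fX x xX xcs) swap_id //; last by apply: contraNneq dX => <-.
  by rewrite -{1}(fX x xX xcs) (inj_eq fI.1).
Qed.

(** The renaming performed by [res c] under its binder; [scons [:: c] id] undoes it and so recovers
    the body. *)
Definition close c b := if b == c then 0 else b.+1.

Lemma open_closeK c : scons [:: c] id \o close c =1 id.
Proof.
move=> x; rewrite /close /scons /=; case: eqP => [->|_] //=.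
by rewrite nth_nil subn1.
Qed.

Lemma mem_fn_res x c P : (x \in fn (res c P)) = (x != c) && (x \in fn P).
Proof.
rewrite /= mem_unbind fn_ren add1n; apply/mapP/andP => [[y yin]|[xc xin]].
  by case: eqP => // yc [->]; split=> //; apply/eqP.
by exists x; rewrite // (negbTE xc).
Qed.

Lemma mem_fn_ress x cs P :
  (x \in fn (ress cs P)) = (x \notin cs) && (x \in fn P).
Proof.
elim: cs => // c cs IH; rewrite [LHS](mem_fn_res x c (ress cs P)) IH inE.
by rewrite negb_or andbA.
Qed.

Lemma ress_cat cs ns P : ress (cs ++ ns) P = ress cs (ress ns P).
Proof. exact: foldr_cat. Qed.

Lemma ren_res f c P : sort_inj f -> ren f (res c P) = res (f c) (ren f P).
Proof.
move=> [fI fS]; rewrite /res /= fS !ren_comp; congr Nu.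
apply: ren_ext => x _ /=; rewrite (inj_eq fI) upE.
by case: (x == c) => //; rewrite ltnS ltn0 subSS subn0.
Qed.

Lemma ren_ress f cs P :
  sort_inj f -> ren f (ress cs P) = ress (map f cs) (ren f P).
Proof. by move=> fS; elim: cs => //= c cs IH; rewrite [LHS]ren_res // IH. Qed.

Lemma ress_alpha f cs P :
  sort_inj f -> {in fn (ress cs P), f =1 id} ->
  ress cs P = ress (map f cs) (ren f P).
Proof. by move=> fS fE; rewrite -ren_ress // ren_id_in. Qed.

Lemma res_swap c d P :
  sort d = sort c -> d \notin fn (res c P) ->
  res c P = res d (ren (swap c d) P).
Proof.
move=> sdc dP; have sI := swap_sort_inj (esym sdc).
have := ren_res c P sI; rewrite swapL => <-; rewrite ren_id_in // => x xin.
apply: swap_id; last by apply: contraNneq dP => <-.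
by move: xin; rewrite mem_fn_res => /andP[].
Qed.

(** Equality of restricted terms is alpha-equivalence. As [d] is not free in [res d Q], the left
    side can be given the bound name [d] too, and opening both bodies at [d] yields the equation. *)
Lemma res_inj_swap c d P Q :
  res c P = res d Q -> sort c = sort d /\ Q = ren (swap c d) P.
Proof.
move=> h; have scd : sort c = sort d by case: h.
have dP : d \notin fn (res c P) by rewrite h mem_fn_res eqxx.
split=> //; move: h; rewrite (res_swap (esym scd) dP) => -[].
rewrite -!/(close d) => /(congr1 (ren (scons [:: d] id))).
rewrite !(ren_comp _ (close d)).
by rewrite !(ren_id_in (f := _ \o _)) // => x _; apply: open_closeK.
Qed.

Lemma ren_swapK a b P : ren (swap a b) (ren (swap a b) P) = P.
Proof. by rewrite ren_comp ren_id_in // => x _; apply: swapK. Qed.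

Lemma act_ren_swapK a b mu : act_ren (swap a b) (act_ren (swap a b) mu) = mu.
Proof. by rewrite act_ren_comp act_ren_id_in // => x _; apply: swapK. Qed.

Lemma lts_ren f P mu P' :
  sort_inj f -> lts P mu P' -> lts (ren f P) (act_ren f mu) (ren f P').
Proof.
move=> fSI; have [fI fS] := fSI.
have mapS bs : map sort (map f bs) = map sort bs.
  by rewrite -map_comp; apply: eq_map.
elim=> {P mu P'} /=.
- by move=> a bs; apply: L_Out.
- move=> a ss P bs e; rewrite (@ren_inst _ _ _ (size ss)) -?e ?size_map //.
  by apply: L_Inp; rewrite mapS.
- move=> a ss P bs e; rewrite (@ren_inst _ _ _ (size ss)) -?e ?size_map //.
  by apply: L_Rep; rewrite mapS.
- by move=> P; apply: L_Tau.
- by move=> a M mu P' _ IH; apply: L_Match.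
- by move=> M1 M2 mu P' _ IH; apply: L_SumL.
- by move=> M1 M2 mu P' _ IH; apply: L_SumR.
- move=> P Q mu P' _ IH h; apply: L_ParL => //.
  by rewrite bn_ren fn_ren; apply: disjoint_map.
- move=> P Q mu P' _ IH h; apply: L_ParR => //.
  by rewrite bn_ren fn_ren; apply: disjoint_map.
- move=> P Q cs a bs P' Q' _ IH1 _ IH2 h; rewrite ren_ress //.
  by apply: L_ComL IH1 IH2 _; rewrite fn_ren; apply: disjoint_map.
- move=> P Q cs a bs P' Q' _ IH1 _ IH2 h; rewrite ren_ress //.
  by apply: L_ComR IH1 IH2 _; rewrite fn_ren; apply: disjoint_map.
- move=> a P mu P' _ IH h; rewrite ![Nu _ _]ren_res //.
  by apply: L_Res IH _; rewrite act_names_ren mem_map.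
- move=> c P cs cs' a bs P' _ IH ca cbs ccs pcs; rewrite [Nu _ _]ren_res //.
  apply: (L_Open IH); rewrite ?(inj_eq fI) ?mem_map //.
  by rewrite -(map_cons f) perm_map.
Qed.

(** * Names and inversion of transitions *)

(** The naming discipline for an action of a process with free names [X]. An early input may receive
    arbitrary names, so only its subject is constrained. *)
Definition act_scoped X mu : Prop :=
  match mu with
  | LTau => True
  | LIn a _ => a \in X
  | LOut cs a bs => [/\ a \in X, {subset cs <= bs}, {subset bs <= X ++ cs} &
                       disjoint_seq cs X]
  end.

Lemma act_scopedW X Y mu :
  act_scoped X mu -> disjoint_seq (bn mu) Y -> {subset X <= Y} ->
  act_scoped Y mu.
Proof.
case: mu => //= [a bs h _ XY|cs a bs [aX csbs bsX _] csY XY]; first exact: XY.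
split=> //; first exact: XY.
by move=> x /bsX; rewrite !mem_cat => /orP[/XY->|->] //; rewrite orbT.
Qed.

Lemma disjoint_catr cs X Y :
  disjoint_seq cs (X ++ Y) = disjoint_seq cs X && disjoint_seq cs Y.
Proof.
apply/disjoint_seqP/andP => [h|[/disjoint_seqP hX /disjoint_seqP hY] x xin].
  by split; apply/disjoint_seqP => x /h; rewrite mem_cat negb_or => /andP[].
by rewrite mem_cat negb_or hX // hY.
Qed.

Lemma act_scoped_bn X mu : act_scoped X mu -> disjoint_seq (bn mu) X.
Proof. by case: mu => //= cs a bs []. Qed.

Lemma disjoint_subr cs X Y :
  {subset Y <= X} -> disjoint_seq cs X -> disjoint_seq cs Y.
Proof.
by move=> YX /disjoint_seqP h; apply/disjoint_seqP => x /h; apply: contra; apply: YX.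
Qed.

(** Outputs arise from messages only, never from guards. The match on the pair keeps both indices of
    [lts] general, as the induction requires. *)
Lemma lts_guarded_out P mu P' :
  lts P mu P' -> (if (P, mu) is (Grd _, LOut _ _ _) then False else True).
Proof. by elim. Qed.

Lemma lts_guarded_bn M mu P' : lts (Grd M) mu P' -> bn mu = [::].
Proof. by move/lts_guarded_out; case: mu. Qed.

Lemma mem_subset_catl X Y : {subset X <= X ++ Y}.
Proof. by move=> x xin; rewrite mem_cat xin. Qed.

Lemma mem_subset_catr X Y : {subset Y <= X ++ Y}.
Proof. by move=> x xin; rewrite mem_cat xin orbT. Qed.

Lemma lts_scoped P mu P' : lts P mu P' -> act_scoped (fn P) mu.
Proof.
elim=> {P mu P'} //; rewrite /= ?mem_head //.
- by move=> a bs; rewrite mem_head; split=> // x xin; rewrite cats0 inE xin orbT.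
- by move=> *; rewrite mem_head.
- by move=> *; rewrite mem_head.
- move=> a M mu P' /lts_guarded_bn bn0 IH; apply: act_scopedW IH _ _.
    by rewrite bn0.
  by move=> x xin; rewrite !inE xin !orbT.
- move=> M1 M2 mu P' /lts_guarded_bn bn0 IH; apply: act_scopedW IH _ _.
    by rewrite bn0.
  exact: mem_subset_catl.
- move=> M1 M2 mu P' /lts_guarded_bn bn0 IH; apply: act_scopedW IH _ _.
    by rewrite bn0.
  exact: mem_subset_catr.
- move=> P Q mu P' _ IH h; apply: act_scopedW (IH) _ _.
    by rewrite disjoint_catr h (act_scoped_bn IH).
  exact: mem_subset_catl.
- move=> P Q mu P' _ IH h; apply: act_scopedW (IH) _ _.
    by rewrite disjoint_catr h (act_scoped_bn IH).
  exact: mem_subset_catr.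
- move=> a P mu P' _; rewrite -[unbind _ _]/(fn (res a P)).
  case: mu => //= [b bs|cs b bs].
    by rewrite -[unbind _ _]/(fn (res a P)) mem_fn_res inE eq_sym negb_or => -> /andP[->].
  rewrite -[unbind _ _]/(fn (res a P)) !(mem_cat, inE) !negb_or.
  move=> [bP csbs bsP csP] /and3P[acs ab abs].
  split=> //; first by rewrite mem_fn_res eq_sym ab.
    move=> x xin; move: (bsP x xin); rewrite !mem_cat mem_fn_res.
    by case/orP=> ->; rewrite ?orbT // andbT; case: eqP => // e; move: abs; rewrite -e xin.
  by apply: disjoint_subr csP => x; rewrite mem_fn_res => /andP[].
- move=> c P cs cs' a bs P' _ [aP csbs bsP csP] ca cbs ccs pcs.
  have mcs := perm_mem pcs.
  rewrite -[unbind _ _]/(fn (res c P)); split.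
  + by rewrite mem_fn_res eq_sym ca.
  + by move=> x; rewrite mcs inE => /orP[/eqP->|/csbs].
  + move=> x /bsP; rewrite !mem_cat mem_fn_res mcs inE.
    by case: (x == c); rewrite ?orbT.
  + apply/disjoint_seqP => x; rewrite mcs inE mem_fn_res => /orP[->//|xcs].
    by rewrite (negbTE (disjoint_seqP _ _ csP x xcs)) andbF.
Qed.

Lemma lts_fn P mu P' : lts P mu P' -> {subset fn P' <= fn P ++ act_names mu}.
Proof.
elim=> {P mu P'}.
- by [].
- move=> a ss P bs e x; have sz : size bs = size ss by rewrite -e size_map.
  by move=> /(mem_fn_inst sz); rewrite /= !(mem_cat, inE) => /orP[]->; rewrite ?orbT.
- move=> a ss P bs e x; have sz : size bs = size ss by rewrite -e size_map.
  rewrite /= mem_cat => /orP[]; last first.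
    by rewrite !(mem_cat, inE) => /orP[]->; rewrite ?orbT.
  by move=> /(mem_fn_inst sz); rewrite /= !(mem_cat, inE) => /orP[]->; rewrite ?orbT.
- by move=> P x; rewrite cats0.
- by move=> a M mu P' _ IH x /IH; rewrite /= !(mem_cat, inE) => /orP[]->; rewrite ?orbT.
- by move=> M1 M2 mu P' _ IH x /IH; rewrite /= !(mem_cat, inE) => /orP[]->; rewrite ?orbT.
- by move=> M1 M2 mu P' _ IH x /IH; rewrite /= !(mem_cat, inE) => /orP[]->; rewrite ?orbT.
- move=> P Q mu P' _ IH _ x; rewrite /= mem_cat => /orP[/IH|xin].
    by rewrite /= !(mem_cat, inE) => /orP[]->; rewrite ?orbT.
  by rewrite !mem_cat xin orbT.
- move=> P Q mu P' _ IH _ x; rewrite /= mem_cat => /orP[xin|/IH].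
    by rewrite !mem_cat xin.
  by rewrite /= !(mem_cat, inE) => /orP[]->; rewrite ?orbT.
- move=> P Q cs a bs P' Q' h IHP _ IHQ _ x.
  have [aP csbs bsP _] := lts_scoped h.
  rewrite mem_fn_ress /= => /andP[xcs]; rewrite !mem_cat => /orP[/IHP|/IHQ].
    rewrite !(mem_cat, inE) (negbTE xcs) /= => /or3P[->//|/eqP->|/bsP].
      by rewrite aP.
    by rewrite mem_cat (negbTE xcs) orbF => ->.
  rewrite !(mem_cat, inE) => /or3P[->|/eqP->|/bsP]; rewrite ?orbT ?aP //.
  by rewrite mem_cat (negbTE xcs) orbF => ->.
- move=> P Q cs a bs P' Q' _ IHP h IHQ _ x.
  have [aP csbs bsP _] := lts_scoped h.
  rewrite mem_fn_ress /= => /andP[xcs]; rewrite !mem_cat => /orP[/IHP|/IHQ].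
    rewrite !(mem_cat, inE) => /or3P[->|/eqP->|/bsP]; rewrite ?orbT ?aP ?orbT //.
    by rewrite mem_cat (negbTE xcs) orbF => ->; rewrite orbT.
  rewrite !(mem_cat, inE) (negbTE xcs) /= => /or3P[->|/eqP->|/bsP].
  + by rewrite orbT.
  + by rewrite aP orbT.
  + by rewrite mem_cat (negbTE xcs) orbF => ->; rewrite orbT.
- move=> a P mu P' _ IH _ x; rewrite mem_fn_res => /andP[xa /IH].
  by rewrite !mem_cat mem_fn_res xa.
- move=> c P cs cs' a bs P' _ IH ca cbs ccs pcs x /IH.
  rewrite !(mem_cat, inE) -/(res c P) mem_fn_res (perm_mem pcs) inE.
  by case: (x =P c) => [->|_] //=; rewrite ?cbs ?orbT.
Qed.

Lemma lts_tau_fn P P' : lts P LTau P' -> {subset fn P' <= fn P}.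
Proof. by move/lts_fn; rewrite cats0. Qed.

Lemma taus_fn P P' : taus P P' -> {subset fn P' <= fn P}.
Proof.
elim=> {P P'} [P P' /lts_tau_fn //|P //|P Q R _ IH1 _ IH2 x /IH2 /IH1 //].
Qed.

(** A renaming that fixes the free names of [P] fixes [P], so equivariance gives another transition
    of the same process with other extruded names. By [lts_in_alpha] a receiver can follow the
    change. *)
Lemma lts_out_alpha f P cs a bs P' :
  sort_inj f -> {in fn P, f =1 id} -> lts P (LOut cs a bs) P' ->
  lts P (LOut (map f cs) a (map f bs)) (ren f P').
Proof.
move=> fS fP h; have [aP _ _ _] := lts_scoped h.
by have := lts_ren fS h; rewrite ren_id_in //= fP.
Qed.

Lemma lts_in_alpha f P a bs P' :
  sort_inj f -> {in fn P, f =1 id} -> lts P (LIn a bs) P' ->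
  lts P (LIn a (map f bs)) (ren f P').
Proof.
move=> fS fP h; have aP := lts_scoped h.
by have := lts_ren fS h; rewrite ren_id_in //= fP.
Qed.

Lemma lts_out_fresh X P cs a bs P' :
  lts P (LOut cs a bs) P' ->
  exists cs' bs' P'', disjoint_seq cs' X /\ lts P (LOut cs' a bs') P''.
Proof.
move=> h; have [_ _ _ /disjoint_seqP csP] := lts_scoped h.
have [f [fS fcs fX]] := fresh_ren (X ++ fn P) cs.
exists (map f cs), (map f bs), (ren f P'); split.
  apply/disjoint_seqP => _ /mapP[x /fcs xin ->].
  by move: xin; rewrite mem_cat negb_or => /andP[].
apply: lts_out_alpha => // x xin; apply: fX; first by rewrite mem_cat xin orbT.
by apply: contraL xin; apply: csP.
Qed.

Variant par_view X P Q mu T : Prop :=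
  | ParViewL P' of lts P mu P' & disjoint_seq (bn mu) (fn Q) & T = Par P' Q
  | ParViewR Q' of lts Q mu Q' & disjoint_seq (bn mu) (fn P) & T = Par P Q'
  | ParViewComL cs a bs P' Q' of mu = LTau &
      lts P (LOut cs a bs) P' & lts Q (LIn a bs) Q' & disjoint_seq cs (fn Q) &
      disjoint_seq cs X & T = ress cs (Par P' Q')
  | ParViewComR cs a bs P' Q' of mu = LTau &
      lts P (LIn a bs) P' & lts Q (LOut cs a bs) Q' & disjoint_seq cs (fn P) &
      disjoint_seq cs X & T = ress cs (Par P' Q').

(* The extruded names of a communication are bound in its result, so they can
   be chosen outside any [X]. *)
Lemma par_inv X P Q mu T : lts (Par P Q) mu T -> par_view X P Q mu T.
Proof.
move E: (Par P Q) => PQ h.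
(* The same renaming serves sender and receiver: it fixes the free names of both, so both
   transitions survive and still agree on the message. *)
have alpha cs P' Q' : disjoint_seq cs (fn P) -> disjoint_seq cs (fn Q) ->
    {subset fn (ress cs (Par P' Q')) <= fn P ++ fn Q} -> exists f,
    [/\ sort_inj f, disjoint_seq (map f cs) (fn P ++ fn Q ++ X),
        {in fn P, f =1 id}, {in fn Q, f =1 id} &
        ress cs (Par P' Q') = ress (map f cs) (Par (ren f P') (ren f Q'))].
  move=> /disjoint_seqP csP /disjoint_seqP csQ sub.
  have [f [fS fcs fX]] := fresh_ren (fn P ++ fn Q ++ X) cs.
  have fP : {in fn P, f =1 id}.
    move=> x xin; apply: fX; first by rewrite mem_cat xin.
    by apply: contraL xin; apply: csP.
  have fQ : {in fn Q, f =1 id}.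
    move=> x xin; apply: fX; first by rewrite !mem_cat xin orbT.
    by apply: contraL xin; apply: csQ.
  exists f; split=> //.
    by apply/disjoint_seqP => _ /mapP[x /fcs xin ->].
  by apply: (@ress_alpha f) => // x /sub; rewrite mem_cat => /orP[/fP|/fQ].
case: h E (h) => // {PQ mu T}.
- by move=> P0 Q0 mu P' h d [-> ->] _; apply: ParViewL h d _.
- by move=> P0 Q0 mu P' h d [-> ->] _; apply: ParViewR h d _.
- move=> P0 Q0 cs a bs P' Q' h1 h2 d [e1 e2] /lts_tau_fn; subst P0 Q0.
  have [_ _ _ csP] := lts_scoped h1.
  case/(alpha _ _ _ csP d) => f [fS]; rewrite !disjoint_catr.
  case/and3P=> _ fQ fX idP idQ ->.
  exact: ParViewComL erefl (lts_out_alpha fS idP h1) (lts_in_alpha fS idQ h2) fQ fX erefl.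
- move=> P0 Q0 cs a bs P' Q' h1 h2 d [e1 e2] /lts_tau_fn; subst P0 Q0.
  have [_ _ _ csQ] := lts_scoped h2.
  case/(alpha _ _ _ d csQ) => f [fS]; rewrite !disjoint_catr.
  case/and3P=> fP _ fX idP idQ ->.
  exact: ParViewComR erefl (lts_in_alpha fS idP h1) (lts_out_alpha fS idQ h2) fP fX erefl.
Qed.

Variant res_view c P mu T : Prop :=
  | ResViewRes P' of lts P mu P' & T = res c P'
  | ResViewOpen d cs cs' a bs of mu = LOut cs' a bs & sort d = sort c &
      d \notin fn (res c P) & d != a & d \in bs & d \notin cs &
      perm_eq cs' (d :: cs) & lts (ren (swap c d) P) (LOut cs a bs) T.

(** The condition on [c] excludes inputs that receive [c] and outputs that extrude the bound name
    under the name [c]; callers rename the binder away from the action beforehand. In the opening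
    case [d] is the bound name used by the derivation, and the body moves with [c] and [d]
    swapped. *)
Lemma res_inv c P mu T :
  lts (res c P) mu T -> c \notin act_names mu -> res_view c P mu T.
Proof.
move E: (res c P) => cP h; case: h E => // {cP mu T}.
- move=> b P0 mu P' h bmu E cmu; have [scb EP] := res_inj_swap E.
  have hS := swap_sort_inj scb.
  (* The rule was applied to a binder [b]; swapping [b] and [c] leaves the action unchanged, since
     it mentions neither. *)
  apply: (@ResViewRes _ _ _ _ (ren (swap c b) P')).
    have := lts_ren hS h; rewrite EP ren_swapK act_ren_id_in // => x xin.
    by apply: swap_id; [apply: contraNneq cmu => <-|apply: contraNneq bmu => <-].
  rewrite (@ren_ext _ _ (swap c b) (swap b c)); last by move=> x _; apply: swapC.
  apply: res_swap => //; rewrite mem_fn_res negb_and negbK.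
  case: eqP => //= /eqP cb; apply/negP => /(lts_fn h).
  rewrite mem_cat (negbTE cmu) orbF => cP0.
  have : c \in fn (res b P0) by rewrite mem_fn_res cb.
  by rewrite -E mem_fn_res eqxx.
- move=> d P0 cs cs' a bs T h da dbs dcs pcs E _; have [scd EP] := res_inj_swap E.
  apply: (@ResViewOpen _ _ _ _ d cs cs' a bs) => //; last by rewrite -EP.
  by rewrite E mem_fn_res eqxx.
Qed.

(** * Structural congruence *)

(* Unused restrictions are not discarded, so congruent processes have the same
   free names. *)
Inductive scong : proc -> proc -> Prop :=
  | SC_Refl P : scong P P
  | SC_Sym P Q : scong P Q -> scong Q P
  | SC_Trans P Q R : scong P Q -> scong Q R -> scong P R
  | SC_ParC P Q : scong (Par P Q) (Par Q P)
  | SC_ParA P Q R : scong (Par (Par P Q) R) (Par P (Par Q R))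
  | SC_Nil P : scong (Par P (Grd Defs.Nil)) P
  | SC_Scope c P Q :
      c \notin fn Q -> scong (Par (res c P) Q) (res c (Par P Q))
  | SC_Swap c d P : scong (res c (res d P)) (res d (res c P))
  | SC_Par P P' Q : scong P P' -> scong (Par P Q) (Par P' Q)
  | SC_Res c P P' : scong P P' -> scong (res c P) (res c P').

Lemma scong_fn P Q : scong P Q -> fn P =i fn Q.
Proof.
elim=> {P Q} //.
- by move=> P Q _ IH x; rewrite IH.
- by move=> P Q R _ IH1 _ IH2 x; rewrite IH1 IH2.
- by move=> P Q x; rewrite !mem_cat orbC.
- by move=> P Q R x; rewrite !mem_cat orbA.
- by move=> P x; rewrite mem_cat orbF.
- move=> c P Q cQ x; rewrite mem_cat !mem_fn_res mem_cat andb_orr.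
  by case: (x =P c) => // ->; rewrite (negbTE cQ).
- by move=> c d P x; rewrite !mem_fn_res andbCA.
- by move=> P P' Q _ IH x; rewrite !mem_cat IH.
- by move=> c P P' _ IH x; rewrite !mem_fn_res IH.
Qed.

Lemma scong_ren f P Q : sort_inj f -> scong P Q -> scong (ren f P) (ren f Q).
Proof.
move=> fS; elim=> {P Q}.
- by move=> P; apply: SC_Refl.
- by move=> P Q _; apply: SC_Sym.
- by move=> P Q R _ IH1 _; apply: SC_Trans.
- by move=> P Q; apply: SC_ParC.
- by move=> P Q R; apply: SC_ParA.
- by move=> P; apply: SC_Nil.
- move=> c P Q cQ; change (scong (Par (ren f (res c P)) (ren f Q)) (ren f (res c (Par P Q)))).
  rewrite !ren_res //; apply: SC_Scope.
  by rewrite fn_ren mem_map //; case: fS.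
- by move=> c d P; rewrite !ren_res //; apply: SC_Swap.
- by move=> P P' Q _; apply: SC_Par.
- by move=> c P P' _ IH; rewrite !ren_res //; apply: SC_Res.
Qed.

Lemma scong_ress cs P Q : scong P Q -> scong (ress cs P) (ress cs Q).
Proof. by move=> h; elim: cs => //= c cs; apply: SC_Res. Qed.

Lemma scong_parr P Q Q' : scong Q Q' -> scong (Par P Q) (Par P Q').
Proof.
move=> h; apply: SC_Trans (SC_ParC _ _) _.
by apply: SC_Trans (SC_Par _ h) (SC_ParC _ _).
Qed.

Lemma scong_ress_res cs c P : scong (ress cs (res c P)) (res c (ress cs P)).
Proof.
elim: cs => [|d cs IH] /=; first exact: SC_Refl.
exact: SC_Trans (SC_Res d IH) (SC_Swap _ _ _).
Qed.

Lemma scong_ress_perm cs cs' P :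
  perm_eq cs cs' -> scong (ress cs P) (ress cs' P).
Proof.
elim: cs cs' => [|c cs IH] cs' pcs.
  by rewrite perm_sym in pcs; rewrite (perm_nilP pcs); apply: SC_Refl.
have cin : c \in cs' by rewrite -(perm_mem pcs) mem_head.
case/splitPr: cs' / cin pcs => cs1 cs2 pcs.
rewrite ress_cat; apply: SC_Trans (SC_Sym (scong_ress_res _ _ _)).
rewrite -ress_cat; apply/SC_Res/IH.
by move: pcs; rewrite perm_sym perm_catC /= perm_cons perm_catC perm_sym.
Qed.

Lemma scong_ress_scope cs P Q :
  disjoint_seq cs (fn Q) -> scong (Par (ress cs P) Q) (ress cs (Par P Q)).
Proof.
elim: cs => [_|c cs IH]; first exact: SC_Refl.
rewrite /disjoint_seq /= negb_or => /andP[cQ csQ].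
exact: SC_Trans (SC_Scope _ cQ) (SC_Res c (IH csQ)).
Qed.

Lemma scong_ress_scoper cs P Q :
  disjoint_seq cs (fn P) -> scong (Par P (ress cs Q)) (ress cs (Par P Q)).
Proof.
move=> h; apply: SC_Trans (SC_ParC _ _) _.
apply: SC_Trans (scong_ress_scope _ h) _.
exact/scong_ress/SC_ParC.
Qed.

(** * Structural congruence is a strong bisimulation *)

(** One half of the strong bisimulation property, with residuals related by [scong]. Proving both
    halves together by induction on the congruence takes care of its symmetry rule. *)
Definition transfers P Q : Prop :=
  forall mu P', lts P mu P' -> exists2 Q', lts Q mu Q' & scong P' Q'.

Lemma transfers_trans P Q R : transfers P Q -> transfers Q R -> transfers P R.
Proof.
move=> h1 h2 mu P' /h1[Q' /h2[R' hR sQ] sP].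
by exists R' => //; apply: SC_Trans sP sQ.
Qed.

Lemma transfers_ren_swap c d P Q :
  sort c = sort d -> transfers P Q ->
  transfers (ren (swap c d) P) (ren (swap c d) Q).
Proof.
move=> /swap_sort_inj cd h mu P' hP.
have := lts_ren cd hP; rewrite ren_swapK => /h[Q' hQ sQ].
exists (ren (swap c d) Q').
  by have := lts_ren cd hQ; rewrite act_ren_swapK.
by rewrite -(ren_swapK c d P'); apply: scong_ren.
Qed.

Lemma disjoint_eqi cs X Y : X =i Y -> disjoint_seq cs X -> disjoint_seq cs Y.
Proof. by move=> e; apply: disjoint_subr => x; rewrite e. Qed.

Lemma transfers_par P P' Q :
  scong P P' -> transfers P P' -> transfers (Par P Q) (Par P' Q).
Proof.
move=> s h mu T /(par_inv [::])[].
- move=> P1 /h[P1' h1 s1] d ->; exists (Par P1' Q); first exact: L_ParL.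
  exact: SC_Par.
- move=> Q' hQ d ->; exists (Par P' Q'); last exact: SC_Par.
  by apply: L_ParR => //; apply: disjoint_eqi (scong_fn s) d.
- move=> cs a bs P1 Q' -> /h[P1' h1 s1] hQ d _ ->.
  exists (ress cs (Par P1' Q')); first exact: L_ComL h1 hQ d.
  exact/scong_ress/SC_Par.
- move=> cs a bs P1 Q' -> /h[P1' h1 s1] hQ d _ ->.
  exists (ress cs (Par P1' Q')); last exact/scong_ress/SC_Par.
  by apply: L_ComR h1 hQ _; apply: disjoint_eqi (scong_fn s) d.
Qed.

Lemma transfers_parC P Q : transfers (Par P Q) (Par Q P).
Proof.
move=> mu T /(par_inv [::])[].
- by move=> P' h d ->; exists (Par Q P'); [apply: L_ParR|apply: SC_ParC].
- by move=> Q' h d ->; exists (Par Q' P); [apply: L_ParL|apply: SC_ParC].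
- move=> cs a bs P' Q' -> h1 h2 d _ ->; exists (ress cs (Par Q' P')).
    exact: L_ComR h2 h1 d.
  exact/scong_ress/SC_ParC.
- move=> cs a bs P' Q' -> h1 h2 d _ ->; exists (ress cs (Par Q' P')).
    exact: L_ComL h2 h1 d.
  exact/scong_ress/SC_ParC.
Qed.

Lemma transfers_nil P : transfers (Par P (Grd Defs.Nil)) P.
Proof.
have nil0 mu T : ~ lts (Grd (@Defs.Nil (srt S))) mu T by move=> h; inversion h.
move=> mu T /(par_inv [::])[].
- by move=> P' h _ ->; exists P' => //; apply: SC_Nil.
- by move=> Q' /nil0.
- by move=> cs a bs P' Q' _ _ /nil0.
- by move=> cs a bs P' Q' _ _ /nil0.
Qed.

Lemma transfers_nil_sym P : transfers P (Par P (Grd Defs.Nil)).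
Proof.
move=> mu P' h; exists (Par P' (Grd Defs.Nil)).
  by apply: L_ParL h _; apply/disjoint_seqP.
exact/SC_Sym/SC_Nil.
Qed.

Lemma transfers_parA P Q R : transfers (Par (Par P Q) R) (Par P (Par Q R)).
Proof.
move=> mu T /(par_inv [::])[].
(* Names passed between [P] and [Q] are chosen outside [R], so that their restriction can be widened
   over [R]. *)
- move=> PQ' /(par_inv (fn R))[].
  + move=> P' h dQ -> dR ->; exists (Par P' (Par Q R)); last exact: SC_ParA.
    by apply: L_ParL => //=; rewrite disjoint_catr dQ.
  + move=> Q' h dP -> dR ->; exists (Par P (Par Q' R)); last exact: SC_ParA.
    by apply: L_ParR => //; apply: L_ParL.
  + move=> cs a bs P' Q' -> hP hQ dQ dR -> _ ->.
    exists (ress cs (Par P' (Par Q' R))).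
      apply: L_ComL hP _ _; first exact: L_ParL hQ _.
      by rewrite /= disjoint_catr dQ.
    apply: SC_Trans (scong_ress_scope _ dR) _.
    exact/scong_ress/SC_ParA.
  + move=> cs a bs P' Q' -> hP hQ dP dR -> _ ->.
    exists (ress cs (Par P' (Par Q' R))).
      by apply: L_ComR hP _ _ => //; apply: L_ParL hQ _.
    apply: SC_Trans (scong_ress_scope _ dR) _.
    exact/scong_ress/SC_ParA.
- move=> R' h; rewrite /= disjoint_catr => /andP[dP dQ] ->.
  exists (Par P (Par Q R')); last exact: SC_ParA.
  by apply: L_ParR => //; apply: L_ParR.
(* [Par P Q] contributes a visible action here, so the communication cases of the inner inversion
   are void. *)
- move=> cs a bs PQ' R' -> /(par_inv [::])[] //.
  + move=> P' hP /= dQ -> hR dR _ ->; exists (ress cs (Par P' (Par Q R'))).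
      apply: L_ComL hP _ _; first by apply: L_ParR hR _; apply/disjoint_seqP.
      by rewrite /= disjoint_catr dQ.
    exact/scong_ress/SC_ParA.
  + move=> Q' hQ /= dP -> hR dR _ ->; exists (Par P (ress cs (Par Q' R'))).
      by apply: L_ParR => //; apply: L_ComL hQ hR dR.
    apply: SC_Trans (SC_Sym (scong_ress_scoper _ dP)).
    exact/scong_ress/SC_ParA.
- move=> cs a bs PQ' R' -> /(par_inv [::])[] //.
  + move=> P' hP _ -> hR; rewrite /= disjoint_catr => /andP[dP dQ] _ ->.
    exists (ress cs (Par P' (Par Q R'))); last exact/scong_ress/SC_ParA.
    by apply: L_ComR hP _ dP; apply: L_ParR.
  + move=> Q' hQ _ -> hR; rewrite /= disjoint_catr => /andP[dP dQ] _ ->.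
    exists (Par P (ress cs (Par Q' R'))).
      by apply: L_ParR => //; apply: L_ComR hQ hR dQ.
    apply: SC_Trans (SC_Sym (scong_ress_scoper _ dP)).
    exact/scong_ress/SC_ParA.
Qed.

(** Commutativity at the outer and the inner level reverses the order of the three components, which
    turns this direction of associativity into the other one. *)
Lemma transfers_parA_sym P Q R :
  transfers (Par P (Par Q R)) (Par (Par P Q) R).
Proof.
apply: (transfers_trans (@transfers_parC _ _)).
apply: (transfers_trans (transfers_par (SC_ParC _ _) (@transfers_parC _ _))).
apply: (transfers_trans (@transfers_parA _ _ _)).
apply: (transfers_trans (@transfers_parC _ _)).
exact: (transfers_par (SC_ParC _ _) (@transfers_parC _ _)).
Qed.

Lemma transfers_res c P P' :
  scong P P' -> transfers P P' -> transfers (res c P) (res c P').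
Proof.
(* The case of a bound name that does not occur in the action; renaming the binder to a fresh name
   reduces the general case to it. *)
have core d Q Q' mu T : scong Q Q' -> transfers Q Q' -> d \notin act_names mu ->
    lts (res d Q) mu T -> exists2 T', lts (res d Q') mu T' & scong T T'.
  move=> s h dmu /res_inv/(_ dmu)[].
    move=> Q1 /h[Q1' h1 s1] ->; exists (res d Q1'); last exact: SC_Res.
    exact: L_Res.
  move=> e cs cs' a bs -> sed eQ ea ebs ecs pcs.
  case/(transfers_ren_swap (esym sed) h) => T' hT' sT; exists T' => //.
  rewrite (res_swap sed).
    exact: L_Open hT' ea ebs ecs pcs.
  by move: eQ; rewrite !mem_fn_res (scong_fn s).
move=> s h mu T.
have [d] := fresh_name (act_names mu ++ fn P) (sort c).
rewrite mem_cat negb_or => /andP[dmu dP] sd.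
have dP' : d \notin fn P' by rewrite -(scong_fn s).
rewrite (res_swap sd) ?mem_fn_res ?(negbTE dP) ?andbF // => hT.
rewrite (res_swap (P := P') sd) ?mem_fn_res ?(negbTE dP') ?andbF //.
apply: core dmu hT; first exact: scong_ren (swap_sort_inj (esym sd)) s.
exact: transfers_ren_swap (esym sd) h.
Qed.

(** Alpha-conversion of a scope that covers [Q] without binding anything in it: the new name cannot
    be free in [Q] either, so [Q] is untouched. *)
Lemma res_par_swap c d P Q :
  sort d = sort c -> c \notin fn Q -> d \notin fn (res c (Par P Q)) ->
  res c (Par P Q) = res d (Par (ren (swap c d) P) Q) /\ d \notin fn Q.
Proof.
move=> sd cQ dPQ; have dQ : d \notin fn Q.
  apply: contra dPQ => dQ; rewrite mem_fn_res mem_cat dQ orbT andbT.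
  by apply: contraNneq cQ => <-.
split=> //; rewrite (res_swap sd dPQ) /= (@ren_id_in _ Q) // => x xin.
by apply: swap_id; [apply: contraNneq cQ => <-|apply: contraNneq dQ => <-].
Qed.

Lemma transfers_scope c P Q :
  c \notin fn Q -> transfers (Par (res c P) Q) (res c (Par P Q)).
Proof.
move=> cQ0 mu T.
(* The binder is renamed to a name foreign to the action, which is then called [c] again. *)
have [d] := fresh_name (act_names mu ++ fn P ++ fn Q) (sort c).
rewrite !mem_cat !negb_or => /and3P[dmu dP dQ] sd.
rewrite (@res_swap c d P) ?mem_fn_res ?(negbTE dP) ?andbF //.
have [|-> _] := @res_par_swap c d P Q sd cQ0.
  by rewrite mem_fn_res mem_cat (negbTE dP) (negbTE dQ) andbF.
move: {P dP} (ren _ P) => P; move: {c sd cQ0} d dmu dQ => c cmu cQ.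
(* Names extruded in a communication are kept distinct from [c], so that the restrictions can be
   exchanged. *)
case/(par_inv [:: c]).
- move=> P1 /res_inv/(_ cmu)[].
    move=> P' hP -> d ->; exists (res c (Par P' Q)); last exact: SC_Scope.
    by apply: L_Res (cmu); apply: L_ParL.
  move=> d cs cs' a bs E sd dP da dbs dcs pcs hP dQ ->; subst mu.
  exists (Par P1 Q); last exact: SC_Refl.
  have /= /disjoint_seqP dQ' := dQ.
  have [|-> _] := @res_par_swap c d P Q sd cQ.
    move: dP; rewrite !mem_fn_res mem_cat => /nandP[/negbTE->//|/negbTE->].
    by rewrite (negbTE (dQ' d _)) ?andbF // (perm_mem pcs) mem_head.
  apply: L_Open da dbs dcs (pcs); apply: L_ParL => //=.
  by apply/disjoint_seqP => x xin; apply: dQ'; rewrite (perm_mem pcs) inE xin orbT.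
- move=> Q' hQ d ->; exists (res c (Par P Q')).
    apply: L_Res (cmu); apply: L_ParR => //.
    apply/disjoint_seqP => x xin; have := disjoint_seqP _ _ d x xin.
    rewrite mem_fn_res; case: (x =P c) => // ex _; move: cmu.
    by rewrite -ex; case: (mu) xin => //= cs a bs xin; rewrite mem_cat xin.
  apply: SC_Scope; apply/negP => /(lts_fn hQ).
  by rewrite mem_cat (negbTE cQ) (negbTE cmu).
- move=> cs a bs P1 Q' -> hP hQ dQ dc ->.
  have ccs : c \notin cs.
    by apply: contraTN dc => ccs; rewrite negbK; apply/hasP; exists c; rewrite ?inE.
  have [aP csbs bsP dP] := lts_scoped hP.
  have ca : c != a by move: aP; rewrite mem_fn_res eq_sym => /andP[].
  have cbs : c \notin bs.
    by apply/negP => /bsP; rewrite mem_cat mem_fn_res eqxx (negbTE ccs).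
  have cmu1 : c \notin act_names (LOut cs a bs).
    by rewrite /= mem_cat inE !negb_or ccs ca.
  case/res_inv/(_ cmu1): hP => [P' hP ->|].
    exists (res c (ress cs (Par P' Q'))).
      by apply: L_Res => //; apply: L_ComL hP hQ dQ.
    apply: SC_Trans (scong_ress_res _ _ _); apply/scong_ress/SC_Scope.
    by apply/negP => /(lts_fn hQ); rewrite mem_cat inE (negbTE cQ) (negbTE ca) (negbTE cbs).
  (* The sender opens its scope under the name [d]. On the left the communication restricts [d]
     again; on the right the scope already covers the receiver. The results differ in the order of
     restrictions. *)
  move=> d cs1 cs' a' bs' [? ? ?] sd dfP da dbs dcs pcs hP; subst cs' a' bs'.
  have /disjoint_seqP dQ' := dQ.
  have [|-> _] := @res_par_swap c d P Q sd cQ.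
    move: dfP; rewrite !mem_fn_res mem_cat => /nandP[/negbTE->//|/negbTE->].
    by rewrite (negbTE (dQ' d _)) ?andbF // (perm_mem pcs) mem_head.
  exists (ress (d :: cs1) (Par P1 Q')); last exact: scong_ress_perm.
  apply: L_Res => //; apply: L_ComL hP hQ _.
  by apply/disjoint_seqP => x xin; apply: dQ'; rewrite (perm_mem pcs) inE xin orbT.
- move=> cs a bs P1 Q' -> hP hQ dP dc ->.
  have ccs : c \notin cs.
    by apply: contraTN dc => ccs; rewrite negbK; apply/hasP; exists c; rewrite ?inE.
  have [aQ csbs bsQ _] := lts_scoped hQ.
  have ca : c != a by apply: contraNneq cQ => ->.
  have cbs : c \notin bs.
    by apply/negP => /bsQ; rewrite mem_cat (negbTE cQ) (negbTE ccs).
  have cmu1 : c \notin act_names (LIn a bs) by rewrite inE negb_or ca.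
  case/res_inv/(_ cmu1): hP => // P' hP ->.
  exists (res c (ress cs (Par P' Q'))).
    apply: L_Res => //; apply: L_ComR hP hQ _.
    apply/disjoint_seqP => x xin; have := disjoint_seqP _ _ dP x xin.
    by rewrite mem_fn_res; case: (x =P c) => // ex; move: ccs; rewrite -ex xin.
  apply: SC_Trans (scong_ress_res _ _ _); apply/scong_ress/SC_Scope.
  apply/negP => /(lts_fn hQ); rewrite !(mem_cat, inE).
  by rewrite (negbTE cQ) (negbTE ca) (negbTE cbs) (negbTE ccs).
Qed.

Lemma transfers_scope_sym c P Q :
  c \notin fn Q -> transfers (res c (Par P Q)) (Par (res c P) Q).
Proof.
move=> cQ0 mu T.
have [d] := fresh_name (act_names mu ++ fn P ++ fn Q) (sort c).
rewrite !mem_cat !negb_or => /and3P[dmu dP dQ] sd.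
rewrite (@res_swap c d P) ?mem_fn_res ?(negbTE dP) ?andbF //.
have [|-> _] := @res_par_swap c d P Q sd cQ0.
  by rewrite mem_fn_res mem_cat (negbTE dP) (negbTE dQ) andbF.
move: {P dP} (ren _ P) => P; move: {c sd cQ0} d dmu dQ => c cmu cQ.
case/res_inv/(_ cmu).
- move=> T' /(par_inv [:: c])[].
  + move=> P' hP d -> ->; exists (Par (res c P') Q).
      by apply: L_ParL => //; apply: L_Res.
    exact/SC_Sym/SC_Scope.
  + move=> Q' hQ d -> ->; exists (Par (res c P) Q').
      apply: L_ParR => //; apply: disjoint_subr d => x.
      by rewrite mem_fn_res => /andP[].
    apply/SC_Sym/SC_Scope; apply/negP => /(lts_fn hQ).
    by rewrite mem_cat (negbTE cQ) (negbTE cmu).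
  + move=> cs a bs P' Q' -> hP hQ dQ dc -> ->.
    have ccs : c \notin cs.
      by apply: contraTN dc => ccs; rewrite negbK; apply/hasP; exists c; rewrite ?inE.
    have aQ := lts_scoped hQ.
    have ca : c != a by apply: contraNneq cQ => ->.
    (* In the answering process [Q] lies outside the scope of [c]. A message that carries [c] must
       extrude it, and the communication restores the restriction; otherwise the restriction stays
       around [P']. *)
    have [cbs|cbs] := boolP (c \in bs).
      exists (ress (c :: cs) (Par P' Q')); last exact: SC_Refl.
      apply: L_ComL (L_Open hP ca cbs ccs (perm_refl _)) hQ _.
      by rewrite /disjoint_seq /= negb_or cQ.
    exists (ress cs (Par (res c P') Q')).
      by apply: L_ComL (L_Res hP _) hQ dQ; rewrite /= mem_cat inE !negb_or ccs ca.
    apply: SC_Trans (SC_Sym (scong_ress_res _ _ _)) _.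
    apply/scong_ress/SC_Sym/SC_Scope; apply/negP => /(lts_fn hQ).
    by rewrite mem_cat inE (negbTE cQ) (negbTE ca) (negbTE cbs).
  + move=> cs a bs P' Q' -> hP hQ dP dc -> ->.
    have ccs : c \notin cs.
      by apply: contraTN dc => ccs; rewrite negbK; apply/hasP; exists c; rewrite ?inE.
    have [aQ csbs bsQ _] := lts_scoped hQ.
    have ca : c != a by apply: contraNneq cQ => ->.
    have cbs : c \notin bs.
      by apply/negP => /bsQ; rewrite mem_cat (negbTE cQ) (negbTE ccs).
    exists (ress cs (Par (res c P') Q')).
      apply: L_ComR (L_Res hP _) hQ _; first by rewrite inE negb_or ca.
      by apply: disjoint_subr dP => x; rewrite mem_fn_res => /andP[].
    apply: SC_Trans (SC_Sym (scong_ress_res _ _ _)) _.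
    apply/scong_ress/SC_Sym/SC_Scope; apply/negP => /(lts_fn hQ).
    by rewrite !(mem_cat, inE) (negbTE cQ) (negbTE ca) (negbTE cbs) (negbTE ccs).
- move=> d cs cs' a bs E sd dPQ da dbs dcs pcs; subst mu.
  have [EPQ dQ] := res_par_swap sd cQ dPQ.
  have [_] := res_inj_swap EPQ => <- /(par_inv [::])[] //.
  + move=> P' hP /= csQ ->; exists (Par P' Q); last exact: SC_Refl.
    apply: L_ParL.
      rewrite (res_swap sd); first exact: L_Open hP da dbs dcs pcs.
      by apply: contra dPQ; rewrite !mem_fn_res mem_cat => /andP[-> ->].
    apply/disjoint_seqP => x /=; rewrite (perm_mem pcs) inE => /orP[/eqP->//|].
    by move: x; apply/disjoint_seqP.
  (* [Q] cannot be the one that emits [d]: it neither has [d] free nor extrudes it among [cs]. *)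
  + move=> Q' hQ; have [_ _ bsQ _] := lts_scoped hQ.
    by move: (bsQ d dbs); rewrite mem_cat (negbTE dQ) (negbTE dcs).
Qed.

(** If both scopes are opened, the two sides extrude the names in different orders, which [L_Open]
    absorbs by admitting every ordering of the extruded set. *)
Lemma transfers_swap c d P : transfers (res c (res d P)) (res d (res c P)).
Proof.
have [->|cd0] := eqVneq c d; first by move=> mu T h; exists T => //; apply: SC_Refl.
move=> mu T; have [f [fS fcs fX]] := fresh_ren (act_names mu ++ fn P) [:: c; d].
have fP : {in fn P, forall x, x != c -> x != d -> f x = x}.
  by move=> x xin xc xd; apply: fX; rewrite ?mem_cat ?xin ?orbT // !inE negb_or xc.
have -> : res c (res d P) = res (f c) (res (f d) (ren f P)).
  rewrite -!ren_res // ren_id_in // => x; rewrite !mem_fn_res => /and3P[xc xd xP].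
  exact: fP.
have -> : res d (res c P) = res (f d) (res (f c) (ren f P)).
  rewrite -!ren_res // ren_id_in // => x; rewrite !mem_fn_res => /and3P[xd xc xP].
  exact: fP.
have := fcs d; have := fcs c; rewrite !inE !eqxx orbT !mem_cat !negb_or.
move=> /(_ isT)/andP[cmu _] /(_ isT)/andP[dmu _].
have : f c != f d by rewrite (inj_eq fS.1).
move: {cd0 fX fP fcs} (f c) (f d) (ren f P) cmu dmu => {}c {}d {fS}{}P cmu dmu cd.
case/res_inv/(_ cmu).
- move=> T' /res_inv/(_ dmu)[].
    move=> P' hP -> ->; exists (res d (res c P')); last exact: SC_Swap.
    by apply: L_Res => //; apply: L_Res.
  move=> e cs cs' a bs E sed edP ea ebs ecs pcs hP ->; subst mu.
  exists (res c T'); last exact: SC_Refl.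
  have ce : c != e.
    by apply: contraNneq cmu => ->; rewrite /= mem_cat inE ebs !orbT.
  have cmu' : c \notin act_names (LOut cs a bs).
    apply: contra cmu; rewrite /= !mem_cat => /orP[h|->]; last by rewrite orbT.
    by rewrite (perm_mem pcs) inE h orbT.
  rewrite (@res_swap d e) //; last first.
    by apply: contra edP; rewrite !mem_fn_res => /and3P[-> _ ->].
  rewrite ren_res ?swap_id //; last exact: swap_sort_inj.
  exact: L_Open (L_Res hP cmu') ea ebs ecs pcs.
- move=> e cs cs' a bs E sec ecP ea ebs ecs pcs; subst mu.
  have de : d != e.
    by apply: contraNneq dmu => ->; rewrite /= mem_cat inE ebs !orbT.
  have dmu' : d \notin act_names (LOut cs a bs).
    apply: contra dmu; rewrite /= !mem_cat => /orP[h|->]; last by rewrite orbT.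
    by rewrite (perm_mem pcs) inE h orbT.
  rewrite ren_res ?swap_id //; [|by rewrite eq_sym|exact: swap_sort_inj].
  have {}ecP : e \notin fn (res c P).
    apply: contra ecP; rewrite !mem_fn_res => /andP[-> ->].
    by rewrite eq_sym de.
  rewrite (res_swap sec ecP).
  case/res_inv/(_ dmu').
    move=> P' hP ->; exists (res d P'); last exact: SC_Refl.
    by apply: L_Res => //; apply: L_Open hP ea ebs ecs pcs.
  move=> g cs1 cs2 a' bs' [? ? ?] sg gP ga gbs gcs pcs1 hP; subst cs2 a' bs'.
  exists T; last exact: SC_Refl.
  have eg : e != g.
    by apply: contraNneq ecs => ->; rewrite (perm_mem pcs1) mem_head.
  rewrite (@res_swap d g) //; last first.
    by apply: contra gP; rewrite !mem_fn_res => /and3P[-> _ ->].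
  rewrite ren_res ?swap_id //; [|by rewrite eq_sym|exact: swap_sort_inj].
  have ecs1 : e \notin cs1.
    by apply: contra ecs => h; rewrite (perm_mem pcs1) inE h orbT.
  apply: L_Open (L_Open hP ea ebs ecs1 (perm_refl _)) ga gbs _ _.
    by rewrite inE negb_or eq_sym eg.
  apply: perm_trans pcs _; rewrite -(perm_cons e) in pcs1.
  apply: perm_trans pcs1 _; rewrite -[e :: g :: _]/([:: e] ++ [:: g] ++ cs1).
  by rewrite perm_catCA.
Qed.

Lemma scong_transfers P Q : scong P Q -> transfers P Q /\ transfers Q P.
Proof.
elim=> {P Q}.
- by move=> P; split=> mu P' h; exists P' => //; apply: SC_Refl.
- by move=> P Q _ [].
- move=> P Q R _ [h1 h2] _ [h3 h4].
  by split; [apply: transfers_trans h1 h3|apply: transfers_trans h4 h2].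
- by move=> P Q; split; apply: transfers_parC.
- by move=> P Q R; split; [apply: transfers_parA|apply: transfers_parA_sym].
- by move=> P; split; [apply: transfers_nil|apply: transfers_nil_sym].
- by move=> c P Q cQ; split; [apply: transfers_scope|apply: transfers_scope_sym].
- by move=> c d P; split; apply: transfers_swap.
- by move=> P P' Q s [h1 h2]; split; apply: transfers_par => //; apply: SC_Sym.
- by move=> c P P' s [h1 h2]; split; apply: transfers_res => //; apply: SC_Sym.
Qed.

Lemma scong_lts P Q mu P' :
  scong P Q -> lts P mu P' -> exists2 Q', lts Q mu Q' & scong P' Q'.
Proof. by case/scong_transfers => h _; apply: h. Qed.

Lemma scong_taus P Q P' :
  scong P Q -> taus P P' -> exists2 Q', taus Q Q' & scong P' Q'.
Proof.
move=> s h; elim: h Q s => {P P'} [P P' h|P|P P1 P2 _ IH1 _ IH2] Q s.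
- by have [Q' hQ s'] := scong_lts s h; exists Q' => //; apply: rt_step.
- by exists Q => //; apply: rt_refl.
- have [Q1 t1 s1] := IH1 _ s; have [Q2 t2 s2] := IH2 _ s1.
  by exists Q2 => //; apply: rt_trans t1 t2.
Qed.

Lemma scong_parAC P Q R : scong (Par (Par P Q) R) (Par (Par P R) Q).
Proof.
apply: SC_Trans (SC_ParA _ _ _) _; apply: SC_Trans (SC_Sym (SC_ParA _ _ _)).
exact/scong_parr/SC_ParC.
Qed.

(* Outputs have no continuation, so an output that is about to be performed
   can be left pending instead: this is what matches the clause
   [Q | a<bs> ==> Q'] of sequential bisimulation. *)
Lemma lts_out_scong P cs a bs P' :
  lts P (LOut cs a bs) P' -> scong P (ress cs (Par P' (Out a bs))).
Proof.
(* The action is made a variable for the induction; the claim is void for actions other than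
   outputs. *)
suff gen mu : lts P mu P' ->
    if mu is LOut cs a bs then scong P (ress cs (Par P' (Out a bs))) else True.
  exact: (gen (LOut cs a bs)).
elim=> {P mu P' cs a bs} //.
- by move=> a bs; apply: SC_Trans (SC_Sym (SC_Nil _)) (SC_ParC _ _).
- by move=> a M [] // cs b bs P' /lts_guarded_out.
- by move=> M1 M2 [] // cs b bs P' /lts_guarded_out.
- by move=> M1 M2 [] // cs b bs P' /lts_guarded_out.
- move=> P Q [] // cs a bs P' _ IH /= d; apply: SC_Trans (SC_Par _ IH) _.
  apply: SC_Trans (scong_ress_scope _ d) _; exact/scong_ress/scong_parAC.
- move=> P Q [] // cs a bs P' _ IH /= d; apply: SC_Trans (scong_parr _ IH) _.
  apply: SC_Trans (scong_ress_scoper _ d) _; exact/scong_ress/SC_Sym/SC_ParA.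
- move=> c P [] // cs a bs P' _ IH cmu; apply: SC_Trans (SC_Res c IH) _.
  apply: SC_Trans (SC_Sym (scong_ress_res _ _ _)) _.
  apply/scong_ress/SC_Sym/SC_Scope.
  by move: cmu; rewrite /= mem_cat negb_or => /andP[].
- move=> c P cs cs' a bs P' _ IH _ _ _ pcs; apply: SC_Trans (SC_Res c IH) _.
  by apply: (@scong_ress_perm (c :: cs)); rewrite perm_sym.
Qed.

(** * Subject reduction *)

Lemma scons_up (T : Type) (ss : seq T) (G G' : nat -> T) f X :
  {in unbind (size ss) X, forall x, G' (f x) = G x} ->
  {in X, forall x, scons ss G' (up (size ss) f x) = scons ss G x}.
Proof.
move=> h x xin; rewrite /scons upE; case: ltnP => le_x.
  exact: set_nth_default.
rewrite !nth_default ?leq_addr // addKn h // mem_unbind subnKC //.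
Qed.

(** Stated for arbitrary [f], because receiving names may identify some of them; typing sees names
    only through their sorts. *)
Lemma typed_in_ren G eta P : typed_in G eta P ->
  forall G' f, {in fn P, forall x, G' (f x) = G x} ->
  typed_in G' eta (ren f P).
Proof.
elim=> {G eta P} /=.
- move=> G a ss P ca _ IH G' f h; apply: T_InpI; first by rewrite h ?mem_head.
  by apply/IH/scons_up => x xin; apply: h; rewrite inE xin orbT.
- move=> G a ss P ca _ IH G' f h; apply: T_InpO; first by rewrite h ?mem_head.
  by apply/IH/scons_up => x xin; apply: h; rewrite inE xin orbT.
- move=> G a ss P ca _ IH G' f h; apply: T_RepO; first by rewrite h ?mem_head.
  by apply/IH/scons_up => x xin; apply: h; rewrite inE xin orbT.
- by move=> G a bs ca G' f h; apply: T_OutO; rewrite h ?mem_head.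
- by move=> G a bs ca G' f h; apply: T_OutI; rewrite h ?mem_head.
- move=> G eta s P _ IH G' f h; apply: T_Nu; apply: IH.
  exact: (@scons_up _ [:: s]).
- by move=> *; apply: T_Nil.
- move=> G eta1 eta2 eta P Q _ IH1 _ IH2 e G' f h.
  by apply: T_Par e; [apply: IH1|apply: IH2] => x xin; apply: h; rewrite mem_cat xin ?orbT.
- move=> G eta M1 M2 _ IH1 _ IH2 G' f h.
  by apply: T_Sum; [apply: IH1|apply: IH2] => x xin; apply: h; rewrite mem_cat xin ?orbT.
- by move=> G eta P _ IH G' f h; apply/T_Tau/IH.
- move=> G a b M _ IH G' f h; apply/T_Match/IH => x xin.
  by apply: h; rewrite !inE xin !orbT.
Qed.

Lemma wsorted_in_ren_mut :
  (forall P (G G' : nat -> srt S) f, {in fn P, forall x, G' (f x) = G x} ->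
     wsorted_in G P -> wsorted_in G' (ren f P)) /\
  (forall M (G G' : nat -> srt S) f, {in fnG M, forall x, G' (f x) = G x} ->
     wsortedG_in G M -> wsortedG_in G' (renG f M)).
Proof.
apply: proc_guarded_ind => //=.
- move=> a bs G G' f h; rewrite h ?mem_head // => <-; rewrite -map_comp.
  by apply/eq_in_map => x xin; apply: h; rewrite inE xin orbT.
- move=> a ss P IH G G' f h; rewrite h ?mem_head // => -[e hP]; split=> //.
  apply: IH hP; apply: scons_up => x xin.
  by apply: h; rewrite inE xin orbT.
- move=> P IHP Q IHQ G G' f h [hP hQ]; split; [apply: IHP hP|apply: IHQ hQ];
  by move=> x xin; apply: h; rewrite mem_cat xin ?orbT.
- move=> s P IH G G' f h hP; apply: (IH (scons [:: s] G)) => //.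
  exact: (@scons_up _ [:: s]).
- move=> a ss P IH G G' f h; rewrite h ?mem_head // => -[e hP]; split=> //.
  apply: IH hP; apply: scons_up => x xin.
  by apply: h; rewrite inE xin orbT.
- move=> a b M IH G G' f h; apply: IH => x xin.
  by apply: h; rewrite !inE xin !orbT.
- move=> P IHP Q IHQ G G' f h [hP hQ]; split; [apply: IHP hP|apply: IHQ hQ];
  by move=> x xin; apply: h; rewrite mem_cat xin ?orbT.
Qed.

Lemma typed_ren (G : nat -> srt S) f eta P :
  (forall x, sort (f x) = G x) ->
  wsorted_in G P /\ typed_in G eta P -> typed eta (ren f P).
Proof.
move=> h [hw ht]; split; last by apply: typed_in_ren ht _ _ _ => x _.
by case: wsorted_in_ren_mut => wr _; apply: wr hw => x _.
Qed.

Lemma typed_inst ss bs eta P :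
  map sort bs = ss -> wsorted_in (scons ss sort) P ->
  typed_in (scons ss sort) eta P -> typed eta (inst bs P).
Proof.
move=> <- hw ht; apply: typed_ren (conj hw ht) => x.
rewrite /scons size_map; case: (ltnP x (size bs)) => h.
  by rewrite (nth_map 0) //; congr (sort _); apply: set_nth_default.
by rewrite !nth_default ?size_map.
Qed.

Lemma typed_res c eta P : typed eta (res c P) <-> typed eta P.
Proof.
split=> [[hw ht]|[hw ht]].
  have -> : P = inst [:: c] (ren (close c) P).
    by rewrite /inst ren_comp ren_id_in // => x _; apply: open_closeK.
  by apply: (@typed_inst [:: sort c]) => //; inversion ht.
have E x : scons [:: sort c] sort (close c x) = sort x.
  by rewrite /close; case: (x =P c) => [->|_] //; rewrite /scons /= nth_nil subn1.
split; last by apply/T_Nu/(typed_in_ren ht) => x _; apply: E.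
by case: wsorted_in_ren_mut => wr _; apply: wr hw => x _; apply: E.
Qed.

Lemma typed_ress cs eta P : typed eta (ress cs P) <-> typed eta P.
Proof. by elim: cs => //= c cs IH; apply: iff_trans (typed_res _ _ _) IH. Qed.

Lemma typed_par (eta1 eta2 eta : bool) P Q :
  typed eta1 P -> typed eta2 Q -> eta1 + eta2 = eta -> typed eta (Par P Q).
Proof. by move=> [? ?] [? ?] e; split; last exact: T_Par e. Qed.

Lemma typed_par_inv eta P Q : typed eta (Par P Q) ->
  exists eta1 eta2 : bool, [/\ typed eta1 P, typed eta2 Q & eta1 + eta2 = eta].
Proof.
move=> [[hP hQ] ht]; inversion ht as [| | | | | | |G eta1 eta2 eta' P' Q' tP tQ e| | |].
by exists eta1, eta2.
Qed.

(** Subject reduction for all actions, type-allowed or not. Inputs at input-controlled names and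
    outputs at output-controlled names come from active processes only. An active process that
    inputs at an output-controlled name may acquire a second active component, so there typability
    is claimed only from the inactive state. *)
Definition typed_after eta mu P' : Prop :=
  match mu with
  | LTau => typed eta P'
  | LOut _ a _ =>
      if outctl (sort a) then eta /\ typed false P' else typed eta P'
  | LIn a _ =>
      if outctl (sort a) then ~~ eta -> typed true P' else eta /\ typed true P'
  end.

Lemma typed_parC eta P Q : typed eta (Par P Q) -> typed eta (Par Q P).
Proof.
case/typed_par_inv=> eta1 [eta2 [tP tQ e]].
by apply: typed_par tQ tP _; rewrite addnC.
Qed.

Lemma typed_after_par (eta1 eta2 eta : bool) mu P' Q :
  typed_after eta1 mu P' -> typed eta2 Q -> eta1 + eta2 = eta ->
  typed_after eta mu (Par P' Q).
Proof.
case: mu => [|a bs|cs a bs] /=; first exact: typed_par.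
- case: ifP => _; case: eta1 eta2 eta => [] [] [] //= h tQ _ //.
  + by move=> _; apply: typed_par (h isT) tQ _.
  + by split=> //; apply: typed_par h.2 tQ _.
  + by case: h.
  + by case: h.
- case: ifP => _; last exact: typed_par.
  case: eta1 eta2 eta => [] [] [] //= [] // _ tP tQ _.
  by split=> //; apply: typed_par tP tQ _.
Qed.

Lemma typed_after_imp eta mu P Q :
  (forall eta', typed eta' P -> typed eta' Q) ->
  typed_after eta mu P -> typed_after eta mu Q.
Proof.
move=> h; case: mu => [|a bs|cs a bs] /=; first exact: h.
  by case: ifP => _; [move=> hP /hP /h|case=> ? /h].
by case: ifP => _; [case=> ? /h|exact: h].
Qed.

(** Activity is conserved. At an output-controlled name the sender is active, the receiver is not,
    and they exchange activities; at an input-controlled name the receiver is active, the sender is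
    not, and neither changes. Either way both halves are type-allowed, so each can serve as a
    challenge in the bisimulation. *)
Lemma typed_com (eta1 eta2 eta : bool) cs a bs P' Q' :
  typed_after eta1 (LOut cs a bs) P' -> typed_after eta2 (LIn a bs) Q' ->
  eta1 + eta2 = eta ->
  let etaP := Defs.next S eta1 (LOut cs a bs) in
  let etaQ := Defs.next S eta2 (LIn a bs) in
  [/\ allowed S eta1 (LOut cs a bs), allowed S eta2 (LIn a bs),
      typed etaP P', typed etaQ Q' & etaP + etaQ = eta].
Proof.
rewrite /= /allowed; case: ifP => _.
  move=> [+ tP]; case: eta1 eta2 eta => [] [] [] //= _ tQ _.
  by split=> //; [constructor 3|constructor 1|exact: tQ].
move=> tP []; case: eta1 eta2 eta tP => [] [] [] //= tP _ tQ _.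
by split=> //; [constructor 1|constructor 3].
Qed.

Lemma typed_lts P mu P' : lts P mu P' ->
  forall eta, typed eta P -> typed_after eta mu P'.
Proof.
elim=> {P mu P'} /=.
- move=> a bs eta [_ ht]; inversion ht as [| | |? ? ? ca|? ? ? ca| | | | | |].
    by rewrite ca; split=> //; split=> //; apply: T_Nil.
  by rewrite (negbTE ca); split=> //; apply: T_Nil.
- move=> a ss P bs e eta [[_ hw] ht].
  inversion ht as [? ? ? ? ca tP|? ? ? ? ca tP| | | | | | | | |].
    by rewrite (negbTE ca); split=> //; apply: typed_inst e hw tP.
  by rewrite ca => _; apply: typed_inst e hw tP.
- move=> a ss P bs e eta h; have [[_ hw] ht] := h.
  inversion ht as [| |? ? ? ? ca tP| | | | | | | |]; subst; rewrite ca => _.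
  by apply: typed_par (typed_inst erefl hw tP) h _.
- by move=> P eta [hw ht]; inversion ht; split.
- by move=> a M mu P' _ IH eta [hw ht]; apply: IH; inversion ht; split.
- by move=> M1 M2 mu P' _ IH eta [[hw _] ht]; apply: IH; inversion ht; split.
- by move=> M1 M2 mu P' _ IH eta [[_ hw] ht]; apply: IH; inversion ht; split.
- move=> P Q mu P' _ IH _ eta /typed_par_inv[eta1 [eta2 [/IH {}IH tQ e]]].
  exact: typed_after_par IH tQ e.
- move=> P Q mu P' _ IH _ eta /typed_par_inv[eta1 [eta2 [tP /IH {}IH e]]].
  apply: (@typed_after_imp _ _ (Par P' P)) => [eta'|]; first exact: typed_parC.
  by apply: typed_after_par IH tP _; rewrite addnC.
- move=> P Q cs a bs P' Q' _ IHP _ IHQ _ eta.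
  case/typed_par_inv=> eta1 [eta2 [/IHP tP /IHQ tQ e]]; apply/typed_ress.
  by have [_ _ tP' tQ' e'] := @typed_com _ _ _ cs a bs _ _ tP tQ e; apply: typed_par tP' tQ' e'.
- move=> P Q cs a bs P' Q' _ IHP _ IHQ _ eta.
  case/typed_par_inv=> eta1 [eta2 [/IHP tP /IHQ tQ]]; rewrite addnC => e.
  apply/typed_ress/typed_parC.
  by have [_ _ tQ' tP' e'] := @typed_com _ _ _ cs a bs _ _ tQ tP e; apply: typed_par tQ' tP' e'.
- move=> c P mu P' _ IH _ eta /typed_res/IH.
  by apply: typed_after_imp => eta' h; apply/typed_res.
- by move=> c P cs cs' a bs P' _ IH _ _ _ _ eta /typed_res/IH.
Qed.

Lemma taus_typed eta P P' : taus P P' -> typed eta P -> typed eta P'.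
Proof. by elim=> {P P'} [P P' /typed_lts h /h|//|P Q R _ h1 _ h2 /h1/h2]. Qed.

(** * Static contexts *)

Lemma taus_ctx (F : proc -> proc) P P' :
  (forall T T', lts T LTau T' -> lts (F T) LTau (F T')) ->
  taus P P' -> taus (F P) (F P').
Proof.
move=> h; elim=> {P P'} [P P' /h|P|P Q R _ h1 _ h2].
- exact: rt_step.
- exact: rt_refl.
- exact: rt_trans h1 h2.
Qed.

Lemma lts_ress_tau ns P P' :
  lts P LTau P' -> lts (ress ns P) LTau (ress ns P').
Proof. by move=> h; elim: ns => //= c ns IH; apply: L_Res. Qed.

Lemma lts_parr_tau P Q Q' : lts Q LTau Q' -> lts (Par P Q) LTau (Par P Q').
Proof. by move=> h; apply: L_ParR. Qed.

Lemma taus_ress_parr ns P Q Q' :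
  taus Q Q' -> taus (ress ns (Par P Q)) (ress ns (Par P Q')).
Proof.
by apply: (@taus_ctx (fun T => ress ns (Par P T))) => T T' /lts_parr_tau/lts_ress_tau.
Qed.

(** A silent action mentions no name, so the binders can stay as they are, and it opens no scope. *)
Lemma ress_tau_inv ns P T :
  lts (ress ns P) LTau T -> exists2 P', lts P LTau P' & T = ress ns P'.
Proof.
elim: ns T => [|c ns IH] T h; first by exists T.
by case: (res_inv h isT) => // T' /IH[P' hP ->] ->; exists P'.
Qed.

(** * Immediate outputs under parallel composition and restriction *)

(** Strong and untyped: whether an output at [a] is type-allowed depends only on the activity and
    the sort of [a], so typing can be treated apart. *)
Definition can_output P a : Prop := exists cs bs P', lts P (LOut cs a bs) P'.

Lemma can_output_scong P Q a : scong P Q -> can_output P a -> can_output Q a.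
Proof.
by move=> s [cs [bs [P' /(scong_lts s)[Q' hQ _]]]]; exists cs, bs, Q'.
Qed.

Lemma can_output_par P Q a :
  can_output (Par P Q) a <-> can_output P a \/ can_output Q a.
Proof.
split=> [[cs [bs [T /(par_inv [::])[]]]] //|].
- by move=> P' h _ _; left; exists cs, bs, P'.
- by move=> Q' h _ _; right; exists cs, bs, Q'.
case=> -[cs0 [bs0 [T]]].
  move=> /(lts_out_fresh (fn Q))[cs [bs [P' [d h]]]].
  by exists cs, bs, (Par P' Q); apply: L_ParL.
move=> /(lts_out_fresh (fn P))[cs [bs [Q' [d h]]]].
by exists cs, bs, (Par P Q'); apply: L_ParR.
Qed.

Lemma can_output_res c P a :
  can_output (res c P) a <-> a != c /\ can_output P a.
Proof.
split=> [[cs0 [bs0 [T0]]]|[ac [cs0 [bs0 [T0]]]]].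
  move=> /(lts_out_fresh [:: c])[cs [bs [T [/disjoint_seqP d h]]]].
  have [aP _ bsP _] := lts_scoped h.
  have ac : a != c by move: aP; rewrite mem_fn_res => /andP[].
  have ccs : c \notin cs by apply/negP => /d; rewrite inE eqxx.
  have cbs : c \notin bs.
    by apply/negP => /bsP; rewrite mem_cat mem_fn_res eqxx (negbTE ccs).
  split=> //; case/res_inv: h.
  - by rewrite /= mem_cat inE !negb_or ccs eq_sym ac.
  - by move=> P' h _; exists cs, bs, P'.
  - move=> e cs1 cs' a' bs' [_ <- _] se _ ea _ _ _.
    move/(lts_ren (swap_sort_inj (esym se))).
    rewrite ren_swapK /= (swap_id ac) 1?eq_sym // => h.
    by do 3!eexists; exact: h.
move=> /(lts_out_fresh [:: c])[cs [bs [T [/disjoint_seqP d h]]]].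
have ccs : c \notin cs by apply/negP => /d; rewrite inE eqxx.
rewrite eq_sym in ac.
have [cbs|cbs] := boolP (c \in bs).
  by exists (c :: cs), bs, T; apply: L_Open h ac cbs ccs _.
exists cs, bs, (res c T); apply: L_Res h _.
by rewrite /= mem_cat inE !negb_or ccs ac.
Qed.

Lemma can_output_ress ns P a :
  can_output (ress ns P) a <-> a \notin ns /\ can_output P a.
Proof.
elim: ns => [|c ns [IH1 IH2]]; first by split=> [|[]].
rewrite inE negb_or; split.
  by move/can_output_res => [-> /IH1[]].
by case=> /andP[ac ans] h; apply/can_output_res; split=> //; apply: IH2.
Qed.

(** * The barbed bisimulation built from a sequential bisimulation *)

Definition sym_rel (Rel : bool -> proc -> proc -> Prop) eta P Q : Prop :=
  Rel eta P Q \/ Rel eta Q P.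

Lemma answersW Q mu (K K' : proc -> Prop) :
  (forall T, K T -> K' T) -> answers Q mu K -> answers Q mu K'.
Proof.
move=> KK' [[Q' h /KK' k]|[a [bs [e [Q' h /KK' k]]]]]; first by left; exists Q'.
by right; exists a, bs; split=> //; exists Q'.
Qed.

Section BisimulationInContext.
Variable Rel : bool -> proc -> proc -> Prop.
Hypothesis bisRel : sequential_bisimulation Rel.

Lemma sym_rel_typed eta P Q :
  sym_rel Rel eta P Q -> typed eta P /\ typed eta Q.
Proof. by case=> /bisRel[]. Qed.

Lemma sym_rel_answers eta P Q mu P' :
  sym_rel Rel eta P Q -> lts P mu P' -> allowed S eta mu ->
  disjoint_seq (bn mu) (fn Q) ->
  answers Q mu (sym_rel Rel (Defs.next S eta mu) P').
Proof.
move=> r h al d; have [tP tQ] := sym_rel_typed r.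
have st : cfg_step eta P mu (Defs.next S eta mu) P' by [].
case: r => /bisRel[_ _ h1 h2].
  by apply: answersW (h1 _ _ _ st d) => T; left.
by apply: answersW (h2 _ _ _ st d) => T; right.
Qed.

(** The total activity [eta'] is a parameter, whereas its division between [R] and the hole varies
    as control passes to and fro. The typings of [U] and [V] are recorded, so they are maintained by
    subject reduction and need not be transported along [scong]. *)
Variant ctx_rel eta' U V : Prop :=
  CtxRel ns R P Q (etaR eta : bool) of typed eta' U & typed eta' V &
    typed etaR R & etaR + eta = eta' & sym_rel Rel eta P Q &
    scong U (ress ns (Par R P)) & scong V (ress ns (Par R Q)).

(** The challenger reaches the required shape literally, the answering side only up to congruence,
    because its reductions may have to be replayed from a process with a pending message. *)
Lemma ctx_rel_step ns R P Q (etaR eta eta' : bool) Z :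
  typed etaR R -> etaR + eta = eta' -> sym_rel Rel eta P Q ->
  lts (ress ns (Par R P)) LTau Z ->
  exists Z' ns' R' P' Q' (etaR' eta1 : bool),
    [/\ taus (ress ns (Par R Q)) Z', typed etaR' R', etaR' + eta1 = eta',
        sym_rel Rel eta1 P' Q' & Z = ress ns' (Par R' P') /\
        scong Z' (ress ns' (Par R' Q'))].
Proof.
move=> tR e r /ress_tau_inv[T hT ->].
have [tP tQ] := sym_rel_typed r.
(* Extruded names are chosen fresh for [Q], so that the same communication can take place with
   [Q]. *)
case: (par_inv (fn Q) hT) => {hT}.
- move=> R' hR _ ->; exists (ress ns (Par R' Q)), ns, R', P, Q, etaR, eta.
  split=> //; last by split=> //; apply: SC_Refl.
    by apply/rt_step/lts_ress_tau/L_ParL.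
  exact: (typed_lts hR tR).
- move=> P' hP _ ->.
  have [|//|[Q' h r']|[? [? []//]]] := sym_rel_answers r hP; first by constructor 2.
  exists (ress ns (Par R Q')), ns, R, P', Q', etaR, eta; split=> //.
    exact: taus_ress_parr.
  by split=> //; apply: SC_Refl.
- move=> cs a bs R' P' _ hR hP _ dQ ->.
  have [aR aP tR' _ e'] := typed_com (typed_lts hR tR) (typed_lts hP tP) e.
  rewrite -ress_cat.
  have [//|[Q' [Q0 [Q1 [t0 hQ t1]]] r']|] := sym_rel_answers r hP aP.
    exists (ress (ns ++ cs) (Par R' Q')), (ns ++ cs), R', P', Q'.
    exists (Defs.next S etaR (LOut cs a bs)), (Defs.next S eta (LIn a bs)).
    split=> //; last by split=> //; apply: SC_Refl.
    apply: rt_trans (taus_ress_parr _ _ t0) _.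
    apply: rt_trans (taus_ress_parr _ _ t1).
    rewrite ress_cat; apply/rt_step/lts_ress_tau; apply: L_ComL hR hQ _.
    exact: disjoint_subr (taus_fn t0) dQ.
  move=> [a' [bs' [[<- <-] [Q' hQ r']]]].
  (* The message of [R] is left pending and handed over to [Q], with the scope of its extruded names
     widened over [Q]. *)
  have s : scong (ress (ns ++ cs) (Par R' (Par Q (Out a bs)))) (ress ns (Par R Q)).
    rewrite ress_cat; apply/scong_ress/SC_Sym.
    apply: SC_Trans (SC_Par _ (lts_out_scong hR)) _.
    apply: SC_Trans (scong_ress_scope _ dQ) _; apply: scong_ress.
    apply: SC_Trans (SC_ParA _ _ _) _; exact/scong_parr/SC_ParC.
  have [Z' tZ sZ] := scong_taus s (taus_ress_parr (ns ++ cs) R' hQ).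
  exists Z', (ns ++ cs), R', P', Q'.
  exists (Defs.next S etaR (LOut cs a bs)), (Defs.next S eta (LIn a bs)).
  by split=> //; split=> //; apply: SC_Sym.
(* Here [P] is the sender, which [typed_com] expects as the first summand. *)
- move=> cs a bs R' P' _ hR hP dR dQ ->; rewrite addnC in e.
  have [aP aR _ tR' e'] := typed_com (typed_lts hP tP) (typed_lts hR tR) e.
  rewrite -ress_cat.
  have [//|[Q' [Q0 [Q1 [t0 hQ t1]]] r']|[? [? []//]]] := sym_rel_answers r hP aP.
  exists (ress (ns ++ cs) (Par R' Q')), (ns ++ cs), R', P', Q'.
  exists (Defs.next S etaR (LIn a bs)), (Defs.next S eta (LOut cs a bs)).
  split=> //; [|by rewrite addnC|by split=> //; apply: SC_Refl].
  apply: rt_trans (taus_ress_parr _ _ t0) _.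
  apply: rt_trans (taus_ress_parr _ _ t1).
  by rewrite ress_cat; apply/rt_step/lts_ress_tau; apply: L_ComR hR hQ dR.
Qed.

Lemma ctx_rel_sym eta U V : ctx_rel eta U V -> ctx_rel eta V U.
Proof.
move=> [ns R P Q etaR eta1 tX tY tR e r sX sY].
by apply: CtxRel tR e _ sY sX => //; case: r; [right|left].
Qed.

Lemma ctx_rel_tau eta U V U' :
  ctx_rel eta U V -> lts U LTau U' -> exists2 V', taus V V' & ctx_rel eta U' V'.
Proof.
move=> [ns R P Q etaR eta1 tX tY tR e r sX sY] hX.
have [Z hZ sZ] := scong_lts sX hX.
have [Z' [ns' [R' [P' [Q' [etaR' [eta2 [tZ' tR' e' r' [EZ sZ']]]]]]]]] :=
  ctx_rel_step tR e r hZ.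
have [V' tauY sY'] := scong_taus (SC_Sym sY) tZ'.
exists V' => //; apply: (@CtxRel _ _ _ ns') tR' e' r' _ _.
- exact: (typed_lts hX tX).
- exact: taus_typed tauY tY.
- by rewrite -EZ; apply: sZ.
- exact: SC_Trans (SC_Sym sY') sZ'.
Qed.

Lemma ctx_rel_taus eta U V U' :
  ctx_rel eta U V -> taus U U' -> exists2 V', taus V V' & ctx_rel eta U' V'.
Proof.
move=> r h; elim: h V r => {U U'} [U U' h|U|U U1 U2 _ IH1 _ IH2] V r.
- exact: ctx_rel_tau r h.
- by exists V => //; apply: rt_refl.
- have [V1 t1 r1] := IH1 _ r; have [V2 t2 r2] := IH2 _ r1.
  by exists V2 => //; apply: rt_trans t1 t2.
Qed.

(** The condition on [a] says that outputs at [a] are type-allowed at [eta]. If [P] is active then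
    so is the whole, so the output is allowed for [P] as well and [Q] answers it. *)
Lemma ctx_rel_can_output eta U V a :
  ctx_rel eta U V -> (eta -> outctl (sort a)) -> can_output U a ->
  exists2 V', taus V V' & can_output V' a.
Proof.
move=> [ns R P Q etaR eta1 tX tY tR e r sX sY] al.
move=> /(can_output_scong sX)/can_output_ress[ans] /can_output_par[oR|].
  exists V; first exact: rt_refl.
  apply: can_output_scong (SC_Sym sY) _.
  by apply/can_output_ress; split=> //; apply/can_output_par; left.
move=> [cs0 [bs0 [P0 /(lts_out_fresh (fn Q))[cs [bs [P' [d hP]]]]]]].
have [tP tQ] := sym_rel_typed r.
have al1 : allowed S eta1 (LOut cs a bs).
  case: eta1 e {r tP tQ} => e; last by constructor 1.
  by constructor 3; split=> //; apply: al; case: eta etaR e {tX tY tR} => [] [].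
have [//|[Q' [Q0 [Q1 [t0 hQ t1]]] r']|[? [? []//]]] := sym_rel_answers r hP al1.
have [V' tY' sY'] := scong_taus (SC_Sym sY) (taus_ress_parr ns R t0).
exists V' => //; apply: can_output_scong sY' _.
apply/can_output_ress; split=> //; apply/can_output_par; right.
by exists cs, bs, Q1.
Qed.

(** It suffices to match the reductions that lead up to the output; the barb of [V] is then
    witnessed with no reductions after it. *)
Lemma ctx_rel_barb eta U V a : ctx_rel eta U V -> barb eta U a -> barb eta V a.
Proof.
move=> r [cs [bs [U' [U0 [U1 [tX [tX0 hX al] _]]]]]].
have [V0 tY r0] := ctx_rel_taus r tX.
have alE : eta -> outctl (sort a) by case: al => [->|//|[_ ->]].
have [|V1 tY1 [cs1 [bs1 [V2 hY]]]] := ctx_rel_can_output r0 alE (a := a).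
  by exists cs, bs, U1.
have tY1' : taus V V1 by apply: rt_trans tY tY1.
exists cs1, bs1, V2, V1, V2; split=> //; last exact: rt_refl.
have tyY : typed eta V by case: r.
split=> //; first exact: taus_typed tY1' tyY.
by case: (eta) alE => alE; [constructor 3; split=> //; apply: alE|constructor 1].
Qed.

Lemma ctx_rel_barbed_bisimulation eta : barbed_bisimulation eta (ctx_rel eta).
Proof.
split=> [U V|U V r]; first exact: ctx_rel_sym.
split.
- by case: r.
- by case: r.
- by move=> U'; apply: ctx_rel_tau.
- by move=> a; split; apply: ctx_rel_barb => //; apply: ctx_rel_sym.
Qed.

End BisimulationInContext.
End Theory.

Theorem mainTheorem1 (S : sorting) (eta : bool) (P Q : proc (srt S))
    (hP : typed eta P) (hQ : typed eta Q)
    (hPQ : sequential_bisimilar eta P Q) :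
  barbed_equivalent eta P Q.
Proof.
case: hPQ => Rel bisRel r; split=> // eta' [ns R] [etaR /= tR e].
exists (ctx_rel Rel eta'); first exact: ctx_rel_barbed_bisimulation.
have fill_typed T : typed eta T -> typed eta' (ress ns (Par R T)).
  by move=> tT; apply/typed_ress/(typed_par tR tT e).
by apply: CtxRel tR e (or_introl r) (SC_Refl _) (SC_Refl _); apply: fill_typed.
Qed.
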